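(* Let $d\ge1$, $p>1$ and $s\in(0,1)$ with $sp<d$, let $p<q<\frac{p(d-s)}{d-sp}$, and set $r=p\frac{q-1}{p-1}$ and \[ a=\frac{d(q-p)}{(q-1)\big(dp-(d-sp)q\big)}, \] where $\delta:=dp-(d-sp)q>0$. Then there is an optimal (i.e. smallest) constant $\mathscr{L}\in(0,\infty)$ such that for every $u\in\mathcal{D}^{p,q}_s$, \[ \|u\|_{L^r(\mathbb{R}^d)}\le\mathscr{L}\,[u]_{W^{s,p}(\mathbb{R}^d)}^a\,\|u\|_{L^q(\mathbb{R}^d)}^{1-a}. \]
   Context: $[u]_{W^{s,p}(\mathbb{R}^d)}^p=\int_{\mathbb{R}^d}\int_{\mathbb{R}^d}\frac{|u(x)-u(y)|^p}{|x-y|^{d+sp}}dx\,dy$; $W^{s,p}(\mathbb{R}^d)$ is the completion of $C_c^\infty(\mathbb{R}^d)$ under $(\|u\|_{L^p}^p+[u]_{W^{s,p}}^p)^{1/p}$; and $\mathcal{D}^{p,q}_s=(W^{s,p}(\mathbb{R}^d)\cap L^q(\mathbb{R}^d))\setminus\{0\}$. *)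

(* Defs.v *)
From HB Require Import structures.
From mathcomp Require Import all_boot all_order all_algebra.
From mathcomp Require Import all_classical all_reals all_analysis.
Set Implicit Arguments. Unset Strict Implicit. Unset Printing Implicit Defensive.
Import Order.TTheory GRing.Theory Num.Theory.
Import numFieldNormedType.Exports.
Local Open Scope classical_set_scope.
Local Open Scope ring_scope.

Section FracSobolev.
Variable R : realType.

(* The Euclidean norm on R^d = 'rV[R]_d (the library's norm on 'rV is the
   max norm, so we define the Euclidean one explicitly). *)
Definition enorm (d : nat) (v : 'rV[R]_d) : R :=
  Num.sqrt (\sum_(i < d) v ord0 i ^+ 2).

Fixpoint iter_lebesgue_int (n : nat) (F : (nat -> R) -> \bar R) : \bar R :=
  match n with
  | 0 => F (fun _ => 0)
  | n'.+1 => (\int[@lebesgue_measure R]_(t in setT)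
               iter_lebesgue_int n'
                 (fun x => F (fun k => if k == n' then t else x k)))%E
  end.

(* Lebesgue integral over R^d of a nonnegative (Borel) function, computed as
   an iterated integral (Tonelli). *)
Definition intRd (d : nat) (f : 'rV[R]_d -> \bar R) : \bar R :=
  iter_lebesgue_int d (fun x => f (\row_(i < d) x i)).

(* Borel measurability of u : R^d -> R (through the product sigma-algebra on
   d.-tuple R, i.e. the Borel sigma-algebra of R^d). *)
Definition rV_of_tuple (d : nat) (t : d.-tuple R) : 'rV[R]_d :=
  \row_(i < d) tnth t i.

Definition measurable_Rd (d : nat) (u : 'rV[R]_d -> R) : Prop :=
  measurable_fun setT (u \o @rV_of_tuple d).

Definition Lp_pow (d : nat) (p : R) (u : 'rV[R]_d -> R) : \bar R :=
  intRd (fun x => ((`|u x|) `^ p)%:E).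

Definition Lp_norm (d : nat) (p : R) (u : 'rV[R]_d -> R) : \bar R :=
  poweR (Lp_pow p u) p^-1.

Definition in_Lp (d : nat) (p : R) (u : 'rV[R]_d -> R) : Prop :=
  measurable_Rd u /\ (Lp_pow p u < +oo)%E.

Definition gagliardo_pow (d : nat) (s p : R) (u : 'rV[R]_d -> R) : \bar R :=
  intRd (fun y => intRd (fun x =>
    ((`|u x - u y| `^ p) / (enorm (x - y) `^ (d%:R + s * p)))%:E)).

Definition gagliardo (d : nat) (s p : R) (u : 'rV[R]_d -> R) : \bar R :=
  poweR (gagliardo_pow s p u) p^-1.

Fixpoint iter_derive (d : nat) (vs : seq 'rV[R]_d) (f : 'rV[R]_d -> R)
  : 'rV[R]_d -> R :=
  match vs with
  | [::] => f
  | v :: vs' => (fun x => derive (iter_derive vs' f) x v)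
  end.

Definition smooth (d : nat) (f : 'rV[R]_d -> R) : Prop :=
  forall (vs : seq 'rV[R]_d) (x : 'rV[R]_d), differentiable (iter_derive vs f) x.

Definition Cc_infty (d : nat) (f : 'rV[R]_d -> R) : Prop :=
  smooth f /\ compact (closure [set x | f x != 0]).

(* W^{s,p}(R^d): completion of C_c^infty under (||.||_p^p + [.]^p)^(1/p),
   realised inside L^p: the limits in that norm of sequences of C_c^infty
   functions. *)
Definition in_Wsp (d : nat) (s p : R) (u : 'rV[R]_d -> R) : Prop :=
  measurable_Rd u /\
  exists phi : nat -> 'rV[R]_d -> R,
    (forall n, Cc_infty (phi n)) /\
    let w n := (fun x => u x - phi n x) in
    ((fun n => Lp_pow p (w n) + gagliardo_pow s p (w n))%E @ \oo --> 0%E).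

(* D^{p,q}_s = (W^{s,p} cap L^q) \ {0}; u <> 0 means u is not a.e. zero. *)
Definition in_Dpqs (d : nat) (s p q : R) (u : 'rV[R]_d -> R) : Prop :=
  in_Wsp s p u /\ in_Lp q u /\ (0 < Lp_pow p u)%E.

End FracSobolev.

(* Main.v *)
(* Writing [D y] for the inner integral of the Gagliardo energy, compare [u y]
   with [u] on a cube around [y] twice as large as the set where
   [|u| > |u y| / 2], which has measure at most [(2 / |u y|)^Q int |u|^Q] by
   Chebyshev. This gives [|u y|^(p + Q s p / d) <= C (int |u|^Q)^(s p / d) D y],
   and integrating in [y] turns control of [L^Q] into control of
   [L^(p + Q s p / d)]. Starting from [Q = q], the exponents increase to the
   critical exponent [d p / (d - s p)], which is larger than [r]; interpolation
   then gives the inequality for [r] without the endpoint Sobolev embedding.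
   The set of admissible constants is closed and is bounded below by a positive
   number, as testing with a smooth bump of finite energy shows, so its infimum
   is the optimal constant. *)

Require Import Defs.
From HB Require Import structures.
From mathcomp Require Import all_boot all_order all_algebra.
From mathcomp Require Import all_classical all_reals all_analysis.
From mathcomp Require Import measurable_realfun lra ring.
Set Implicit Arguments. Unset Strict Implicit. Unset Printing Implicit Defensive.
Import Order.TTheory GRing.Theory Num.Theory.
Import numFieldNormedType.Exports.
Local Open Scope classical_set_scope.
Local Open Scope ring_scope.

(** * Iterated Lebesgue integrals *)

(** The map [Q |-> p + Q s p / d] contracts towards its fixed point, the critical exponent, so
    finitely many steps pass any smaller exponent; the upper bound imposed on [q] says exactly that
    [r] is smaller. At every stage the powers of the two energies are forced by scaling and are
    affine in the exponent. One family of inequalities, [GN_ineq], is therefore preserved both by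
    the gain of integrability and by interpolation, and [a] and [1 - a] appear only at the end, on
    taking a power [1 / r]. The obstacle is that integrals over R^d are iterated one-dimensional
    integrals, with no product measure behind them. Additivity, series and null-set arguments are
    rebuilt one coordinate at a time, with measurability tested along parametrized families. This
    shapes the analysis: cubes replace Euclidean balls, pointwise inequalities between integrands
    replace integration over superlevel sets and the Hölder inequality, and the energy of the bump
    is bounded by series of cube indicators instead of polar coordinates. *)

Section IterInt.
Variable R : realType.
Implicit Types F G : (nat -> R) -> \bar R.

Let mu := @lebesgue_measure R.

(** The integral of a nonnegative function is a supremum over the simple functions below it, so
    monotonicity is an inclusion of sets of competitors. Iterated integrals can then be compared
    without inspecting their partial integrals. *)
Lemma ge0_le_integral_nomeas (f g : R -> \bar R) :
  (forall t, 0 <= f t)%E -> (forall t, f t <= g t)%E ->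
  (\int[mu]_(t in setT) f t <= \int[mu]_(t in setT) g t)%E.
Proof.
move=> f0 fg.
have g0 t : (0 <= g t)%E by exact: le_trans (fg t).
rewrite !ge0_integralTE//; apply: le_ereal_sup => _ [h hf <-].
by exists h => // t; exact: le_trans (hf t) (fg t).
Qed.

Definition upd (x : nat -> R) (n : nat) (t : R) : nat -> R :=
  fun k => if k == n then t else x k.

Lemma iter_intS n F : iter_lebesgue_int n.+1 F =
  (\int[mu]_(t in setT) iter_lebesgue_int n (fun x => F (upd x n t)))%E.
Proof. by []. Qed.

Lemma iter_int_ge0 n F : (forall x, 0 <= F x)%E -> (0 <= iter_lebesgue_int n F)%E.
Proof.
by elim: n F => [|n IH] F F0 //=; apply: integral_ge0 => t _; exact: IH.
Qed.

Lemma le_iter_int n F G : (forall x, 0 <= F x)%E -> (forall x, F x <= G x)%E ->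
  (iter_lebesgue_int n F <= iter_lebesgue_int n G)%E.
Proof.
elim: n F G => [|n IH] F G F0 FG; first exact: FG.
rewrite !iter_intS; apply: ge0_le_integral_nomeas => t; first exact: iter_int_ge0.
exact: IH.
Qed.

(* Stability under every measurable parametrization replaces a sigma-algebra on
   [nat -> R] and passes through the recursion of [iter_lebesgue_int]. *)
Definition param_coord_measurable (d : measure_display) (T : measurableType d)
    (F : T -> (nat -> R) -> \bar R) : Prop :=
  forall (d' : measure_display) (T' : measurableType d') (f : T' -> T)
    (X : T' -> nat -> R), measurable_fun setT f ->
    (forall k, measurable_fun setT (fun t => X t k)) ->
    measurable_fun setT (fun t => F (f t) (X t)).

Lemma measurable_upd (d : measure_display) (T : measurableType d)
    (X : T -> nat -> R) (g : T -> R) n :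
  measurable_fun setT g -> (forall k, measurable_fun setT (fun t => X t k)) ->
  forall k, measurable_fun setT (fun t => upd (X t) n (g t) k).
Proof. by move=> mg mX k; rewrite /upd; case: (k == n). Qed.

(** The outermost variable is moved into the parameter space, [T] becoming [T * R], and Tonelli's
    theorem makes the partial integral measurable. This is why [T] varies along the induction. *)
Lemma measurable_iter_int (n : nat) (d : measure_display) (T : measurableType d)
    (F : T -> (nat -> R) -> \bar R) :
  (forall t x, 0 <= F t x)%E -> param_coord_measurable F ->
  measurable_fun setT (fun t => iter_lebesgue_int n (F t)).
Proof.
elim: n d T F => [|n IH] d T F F0 mF.
  apply: (mF _ _ id (fun _ _ => 0)) => // k; exact: measurable_cst.
pose H (z : T * R) := iter_lebesgue_int n (fun x => F z.1 (upd x n z.2)).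
have mH : measurable_fun setT H.
  apply: (IH _ _ (fun (z : T * R) x => F z.1 (upd x n z.2))).
    by move=> z x; exact: F0.
  move=> d' T' f X mf mX; apply: (mF _ _ (fst \o f)).
    exact: measurableT_comp.
  by apply: measurable_upd => //; exact: measurableT_comp.
have H0 z : (0 <= H z)%E by apply: iter_int_ge0 => x; exact: F0.
exact: (measurable_fun_fubini_tonelli_F (m2 := mu) _ mH H0).
Qed.

Definition coord_measurable F : Prop :=
  forall (d' : measure_display) (T' : measurableType d') (X : T' -> nat -> R),
    (forall k, measurable_fun setT (fun t => X t k)) ->
    measurable_fun setT (fun t => F (X t)).

Lemma coord_measurable_upd F n t :
  coord_measurable F -> coord_measurable (fun x => F (upd x n t)).
Proof.
by move=> mF d T X mX; apply: mF; apply: measurable_upd => //; exact: measurable_cst.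
Qed.

Lemma measurable_iter_upd F n : (forall x, 0 <= F x)%E -> coord_measurable F ->
  measurable_fun setT (fun t : R => iter_lebesgue_int n (fun x => F (upd x n t))).
Proof.
move=> F0 mF; apply: (@measurable_iter_int n _ _ (fun (t : R) x => F (upd x n t))).
  by move=> t x; exact: F0.
by move=> d T f X mf mX; apply: mF; exact: measurable_upd.
Qed.

Lemma iter_intD n F G : (forall x, 0 <= F x)%E -> (forall x, 0 <= G x)%E ->
  coord_measurable F -> coord_measurable G ->
  iter_lebesgue_int n (fun x => F x + G x)%E =
  (iter_lebesgue_int n F + iter_lebesgue_int n G)%E.
Proof.
elim: n F G => [|n IH] F G F0 G0 mF mG //.
rewrite !iter_intS -ge0_integralD//.
- by apply: eq_integral => t _; rewrite IH//; exact: coord_measurable_upd.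
- by move=> t _; exact: iter_int_ge0.
- exact: measurable_iter_upd.
- by move=> t _; exact: iter_int_ge0.
- exact: measurable_iter_upd.
Qed.

Lemma iter_intZ n F (c : R) : 0 <= c -> (forall x, 0 <= F x)%E -> coord_measurable F ->
  iter_lebesgue_int n (fun x => c%:E * F x)%E = (c%:E * iter_lebesgue_int n F)%E.
Proof.
elim: n F => [|n IH] F c0 F0 mF //.
rewrite !iter_intS -ge0_integralZl_EFin//.
- by apply: eq_integral => t _; rewrite IH//; exact: coord_measurable_upd.
- by move=> t _; exact: iter_int_ge0.
- exact: measurable_iter_upd.
Qed.

Lemma iter_int_nneseries n (F : nat -> (nat -> R) -> \bar R) :
  (forall k x, 0 <= F k x)%E -> (forall k, coord_measurable (F k)) ->
  iter_lebesgue_int n (fun x => \sum_(k <oo) F k x)%E =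
  (\sum_(k <oo) iter_lebesgue_int n (F k))%E.
Proof.
elim: n F => [|n IH] F F0 mF //.
rewrite iter_intS -integral_nneseries//.
- apply: eq_integral => t _; rewrite (IH (fun k x => F k (upd x n t)))//.
  by move=> k; exact: coord_measurable_upd.
- by move=> k; exact: measurable_iter_upd.
- by move=> k t _; exact: iter_int_ge0.
Qed.

(** Takes the place of null sets of R^d: a vanishing integral forces the inner integrals to vanish
    for almost every value of the outer variable, and the induction passes this on to [G]. *)
Lemma iter_int_eq0 n F G : (forall x, 0 <= F x)%E -> (forall x, 0 <= G x)%E ->
  coord_measurable F -> coord_measurable G -> (forall x, F x = 0 -> G x = 0)%E ->
  iter_lebesgue_int n F = 0%E -> iter_lebesgue_int n G = 0%E.
Proof.
elim: n F G => [|n IH] F G F0 G0 mF mG FG; first exact: FG.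
have F0' t : (0 <= iter_lebesgue_int n (fun x => F (upd x n t)))%E by exact: iter_int_ge0.
have mF' := measurable_iter_upd n F0 mF.
rewrite !iter_intS => HF.
have : ae_eq mu setT (fun t => iter_lebesgue_int n (fun x => F (upd x n t))) (cst 0%E).
  apply/ae_eq_integral_abs => //; rewrite -[RHS]HF.
  by apply: eq_integral => t _; rewrite gee0_abs.
move=> aeF; rewrite -(integral0 mu setT); apply: ge0_ae_eq_integral => //.
- exact: measurable_iter_upd.
- by move=> t _; exact: iter_int_ge0.
- apply: filterS aeF => t /= /(_ I) HFt _.
  apply: (IH (fun x => F (upd x n t))) => //; try exact: coord_measurable_upd.
  by move=> x; exact: FG.
Qed.

Lemma iter_int_cst0 n : iter_lebesgue_int n (fun _ => 0%E) = 0%E :> \bar R.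
Proof. by elim: n => [|n IH] //; rewrite iter_intS IH integral0. Qed.

(** Testing along [iota 0 n] makes the outermost variable the last conjunct, so each slice of the
    box is a box of one dimension less, or empty. *)
Lemma iter_int_box n (c : nat -> R) (rho : R) : 0 < rho ->
  iter_lebesgue_int n (fun x => (all (fun k => `|x k - c k| <= rho) (iota 0 n))%:R%:E)
  = ((2 * rho) ^+ n)%:E.
Proof.
move=> rho0; elim: n => [|n IH]; first by rewrite /= expr0.
pose I : set R := `[c n - rho, c n + rho]%classic.
have step t : iter_lebesgue_int n (fun x =>
    (all (fun k => `|upd x n t k - c k| <= rho) (iota 0 n.+1))%:R%:E)
    = (((2 * rho) ^+ n)%:E * (\1_I t)%:E)%E.
  have eqb x : all (fun k => `|upd x n t k - c k| <= rho) (iota 0 n.+1) =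
      (all (fun k => `|x k - c k| <= rho) (iota 0 n)) && (t \in I).
    rewrite -addn1 iotaD all_cat /= add0n andbT; congr (_ && _).
      apply: eq_in_all => k; rewrite mem_iota add0n => /andP[_ kn].
      by rewrite /upd (ltn_eqF kn).
    rewrite /upd eqxx mem_setE in_itv/= ler_distl.
    done.
  under eq_fun do rewrite eqb.
  rewrite indicE; case: (t \in I).
    by under eq_fun do rewrite andbT; rewrite IH mule1.
  by under eq_fun do rewrite andbF; rewrite mule0 iter_int_cst0.
rewrite iter_intS; under eq_integral do rewrite step.
have mI : measurable_fun setT (fun t : R => (\1_I t : R)%:E).
  by apply/measurable_EFinP; apply: measurable_indic; exact: measurable_itv.
have rho_ge0 : 0 <= (2 * rho) ^+ n by rewrite exprn_ge0// mulr_ge0// ltW.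
rewrite ge0_integralZl_EFin//.
rewrite integral_indic//; last exact: measurable_itv.
have muI : lebesgue_measure I = (2 * rho)%:E.
  rewrite /I lebesgue_measure_itv/= lte_fin ifT; last by lra.
  by rewrite -EFinD; congr (_%:E); lra.
by rewrite setIT exprSr EFinM; congr (_ * _)%E; exact: muI.
Qed.
End IterInt.

(** * Integrals over R^d, cubes and the Gagliardo kernel *)

Section IntRd.
Variables (R : realType) (d : nat).
Implicit Types f g : 'rV[R]_d -> \bar R.

Definition measurable_coords (dT : measure_display) (T : measurableType dT)
    (X : T -> 'rV[R]_d) : Prop :=
  forall i, measurable_fun setT (fun t => X t ord0 i).

Definition emeasurable_Rd f : Prop :=
  forall (dT : measure_display) (T : measurableType dT) (X : T -> 'rV[R]_d),
    measurable_coords X -> measurable_fun setT (fun t => f (X t)).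

Lemma emeasurable_Rd_coord f : emeasurable_Rd f ->
  coord_measurable (fun x => f (\row_(i < d) x i)).
Proof.
by move=> mf dT T X mX; apply: mf => i; under eq_fun do rewrite mxE; exact: mX.
Qed.

(** Links Borel measurability on tuples to the parametrized form, by factoring a family of points
    through [d.-tuple R]. *)
Lemma measurable_Rd_comp (u : 'rV[R]_d -> R) : measurable_Rd u ->
  forall (dT : measure_display) (T : measurableType dT) (X : T -> 'rV[R]_d),
    measurable_coords X -> measurable_fun setT (fun t => u (X t)).
Proof.
move=> mu dT T X mX; pose Y t := [tuple X t ord0 i | i < d].
have -> : (fun t => u (X t)) = (u \o @rV_of_tuple R d) \o Y.
  apply: funext => t /=; congr u; apply/rowP => i.
  by rewrite mxE tnth_mktuple.
apply: measurableT_comp => //; apply/measurable_fun_tnthP => i.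
rewrite (_ : _ \o _ = fun t => X t ord0 i); first exact: mX.
by apply: funext => t /=; rewrite tnth_mktuple.
Qed.

Lemma intRd_ge0 f : (forall x, 0 <= f x)%E -> (0 <= intRd f)%E.
Proof. by move=> f0; exact: iter_int_ge0. Qed.

Lemma le_intRd f g : (forall x, 0 <= f x)%E -> (forall x, f x <= g x)%E ->
  (intRd f <= intRd g)%E.
Proof. by move=> f0 fg; exact: le_iter_int. Qed.

Lemma intRdD f g : (forall x, 0 <= f x)%E -> (forall x, 0 <= g x)%E ->
  emeasurable_Rd f -> emeasurable_Rd g ->
  intRd (fun x => f x + g x)%E = (intRd f + intRd g)%E.
Proof.
by move=> f0 g0 mf mg; apply: iter_intD => //; exact: emeasurable_Rd_coord.
Qed.

Lemma intRdZ f (c : R) : 0 <= c -> (forall x, 0 <= f x)%E -> emeasurable_Rd f ->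
  intRd (fun x => c%:E * f x)%E = (c%:E * intRd f)%E.
Proof. by move=> c0 f0 mf; apply: iter_intZ => //; exact: emeasurable_Rd_coord. Qed.

Lemma intRd_nneseries (f : nat -> 'rV[R]_d -> \bar R) :
  (forall k x, 0 <= f k x)%E -> (forall k, emeasurable_Rd (f k)) ->
  intRd (fun x => \sum_(k <oo) f k x)%E = (\sum_(k <oo) intRd (f k))%E.
Proof.
move=> f0 mf; rewrite /intRd -iter_int_nneseries// => k.
exact: emeasurable_Rd_coord.
Qed.

Lemma intRd_eq0 f g : (forall x, 0 <= f x)%E -> (forall x, 0 <= g x)%E ->
  emeasurable_Rd f -> emeasurable_Rd g -> (forall x, f x = 0 -> g x = 0)%E ->
  intRd f = 0%E -> intRd g = 0%E.
Proof.
move=> f0 g0 mf mg fg; apply: iter_int_eq0 => //; first exact: emeasurable_Rd_coord.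
  exact: emeasurable_Rd_coord.
by move=> x; exact: fg.
Qed.

Lemma emeasurable_Rd_intRd (k : 'rV[R]_d -> 'rV[R]_d -> \bar R) :
  (forall y x, 0 <= k y x)%E ->
  (forall (dT : measure_display) (T : measurableType dT) (Y X : T -> 'rV[R]_d),
    measurable_coords Y -> measurable_coords X ->
    measurable_fun setT (fun t => k (Y t) (X t))) ->
  emeasurable_Rd (fun y => intRd (k y)).
Proof.
move=> k0 mk dT T Y mY.
apply: (@measurable_iter_int _ d _ _ (fun t x => k (Y t) (\row_(i < d) x i))) => //.
move=> dT' T' f X mf mX; apply: (mk _ _ (Y \o f)) => i.
  exact: (measurableT_comp (mY i)).
by under eq_fun do rewrite mxE; exact: mX.
Qed.

(** A closed ball of the max norm: its volume comes directly from iterated integration, at the price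
    of a factor [sqrt d] in Euclidean distances. *)
Definition in_cube (c : 'rV[R]_d) (rho : R) (x : 'rV[R]_d) : bool :=
  [forall i, `|x ord0 i - c ord0 i| <= rho].

Definition cube_ind c rho x : \bar R := (in_cube c rho x)%:R%:E.

Lemma cube_ind_ge0 c rho x : (0 <= cube_ind c rho x)%E.
Proof. by rewrite lee_fin. Qed.

Lemma emeasurable_cube_ind c rho : emeasurable_Rd (cube_ind c rho).
Proof.
move=> dT T X mX; apply/measurable_EFinP.
(* As a finite product of one-coordinate tests the indicator is visibly measurable. *)
have -> : (fun t => (in_cube c rho (X t))%:R : R) =
    (fun t => \prod_(i <- index_enum 'I_d)
       (if `|X t ord0 i - c ord0 i| <= rho then 1 else 0)).
  apply: funext => t; rewrite /in_cube; case: forallP => [h|/forallP].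
    by rewrite big1 // => i _; rewrite h.
  rewrite negb_forall => /existsP[i hi].
  by rewrite (bigD1 i)//= (negbTE hi) mul0r.
apply: measurable_prod => i _.
refine (@measurable_fun_ifT _ _ T (measurableTypeR R) (cst 1) (cst 0) _ _
  (measurable_cst _) (measurable_cst _)).
apply: measurable_fun_ler => //; apply: measurableT_comp => //.
by apply: measurable_funB.
Qed.

Lemma intRd_cube c rho : 0 < rho -> intRd (cube_ind c rho) = ((2 * rho) ^+ d)%:E.
Proof.
(* The centre is extended by [0] to a sequence; only its entries below [d] are ever tested. *)
move=> rho0; pose c' k := oapp (c ord0) 0 (insub k).
rewrite -(@iter_int_box _ d c')// /intRd; congr iter_lebesgue_int.
apply: funext => x; rewrite /cube_ind; congr ((_ : bool)%:R%:E).
have c'E (i : 'I_d) : c' i = c ord0 i by rewrite /c' valK.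
apply/forallP/allP => [h k|h i].
  rewrite mem_iota add0n => /andP[_ kd].
  by have := h (Ordinal kd); rewrite mxE -c'E.
by rewrite mxE -c'E; apply: h; rewrite mem_iota add0n leq0n ltn_ord.
Qed.

Lemma measurable_enorm (dT : measure_display) (T : measurableType dT)
    (X : T -> 'rV[R]_d) :
  measurable_coords X -> measurable_fun setT (fun t => enorm (X t)).
Proof.
move=> mX; rewrite /enorm.
have -> : (fun t => Num.sqrt (\sum_(i < d) X t ord0 i ^+ 2)) =
    (fun t => (\sum_(i < d) X t ord0 i ^+ 2) `^ 2^-1).
  by apply: funext => t; rewrite powR12_sqrt// sumr_ge0// => i _; exact: sqr_ge0.
apply: (measurableT_comp (measurable_powR _)).
by apply: measurable_sum => i; exact: measurable_funX.
Qed.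

Definition gkernel (s p : R) (u : 'rV[R]_d -> R) (y x : 'rV[R]_d) : \bar R :=
  ((`|u x - u y| `^ p) / (enorm (x - y) `^ (d%:R + s * p)))%:E.

Lemma gkernel_ge0 s p u y x : (0 <= gkernel s p u y x)%E.
Proof. by rewrite lee_fin divr_ge0// powR_ge0. Qed.

Lemma measurable_gkernel s p u : measurable_Rd u ->
  forall (dT : measure_display) (T : measurableType dT) (Y X : T -> 'rV[R]_d),
    measurable_coords Y -> measurable_coords X ->
    measurable_fun setT (fun t => gkernel s p u (Y t) (X t)).
Proof.
move=> mu dT T Y X mY mX; apply/measurable_EFinP.
apply: measurable_funM.
  apply: (measurableT_comp (measurable_powR _)); apply: measurableT_comp => //.
  by apply: measurable_funB; exact: measurable_Rd_comp.
under eq_fun do rewrite -powRN.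
apply: (measurableT_comp (measurable_powR _)).
apply: measurable_enorm => i; under eq_fun do rewrite !mxE.
exact: measurable_funB.
Qed.

Lemma emeasurable_gkernel s p u y : measurable_Rd u ->
  emeasurable_Rd (gkernel s p u y).
Proof.
by move=> mu dT T X mX; apply: (measurable_gkernel _ _ mu (Y := fun=> y)).
Qed.

Lemma emeasurable_int_gkernel s p u : measurable_Rd u ->
  emeasurable_Rd (fun y => intRd (gkernel s p u y)).
Proof.
move=> mu; apply: emeasurable_Rd_intRd; first exact: gkernel_ge0.
exact: measurable_gkernel.
Qed.

Lemma emeasurable_powR p u : measurable_Rd u ->
  emeasurable_Rd (fun x => (`|u x| `^ p)%:E).
Proof.
move=> mu dT T X mX; apply/measurable_EFinP.
apply: (measurableT_comp (measurable_powR _)); apply: measurableT_comp => //.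
exact: measurable_Rd_comp.
Qed.

(** Both integrands vanish exactly where [u] does. This transfers nontriviality of [u] from the
    exponent [p] to the exponent [q]. *)
Lemma Lp_pow_eq0 p q (u : 'rV[R]_d -> R) : q != 0 -> p != 0 -> measurable_Rd u ->
  Lp_pow q u = 0%E -> Lp_pow p u = 0%E.
Proof.
move=> q0 p0 mu; apply: intRd_eq0.
- by move=> x; rewrite lee_fin powR_ge0.
- by move=> x; rewrite lee_fin powR_ge0.
- exact: emeasurable_powR.
- exact: emeasurable_powR.
- move=> x [/eqP]; rewrite powR_eq0 => /andP[/eqP -> _].
  by rewrite powR0.
Qed.

Lemma coord_le_enorm (x : 'rV[R]_d) i : `|x ord0 i| <= enorm x.
Proof.
rewrite /enorm -sqrtr_sqr ler_wsqrtr// (bigD1 i)//= lerDl.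
by apply: sumr_ge0 => j _; exact: sqr_ge0.
Qed.

Lemma enorm_ge0 (x : 'rV[R]_d) : 0 <= enorm x.
Proof. exact: sqrtr_ge0. Qed.

Lemma enorm_le_cube c (rho : R) (x : 'rV[R]_d) : 0 <= rho -> in_cube c rho x ->
  enorm (x - c) <= Num.sqrt d%:R * rho.
Proof.
move=> rho0 /forallP h; rewrite /enorm.
rewrite -[X in _ * X](ger0_norm rho0) -sqrtr_sqr -sqrtrM ?ler0n// ler_wsqrtr//.
rewrite -[d in d%:R]card_ord mulr_natl -sumr_const; apply: ler_sum => i _.
rewrite !mxE -(real_normK (num_real (_ - _))) ler_sqr ?nnegrE//; exact: h.
Qed.

End IntRd.

(** * Self-improving integrability *)

Section GagliardoNirenberg.
Variables (R : realType) (d : nat) (p s : R).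
Hypotheses (d_gt0 : (0 < d)%N) (p_gt0 : 0 < p) (s_gt0 : 0 < s).
Implicit Types u : 'rV[R]_d -> R.

(** The slope of the exponent map [Q |-> p + Q * sig], whose fixed point is
    [p / (1 - sig) = d p / (d - s p)]. *)
Let sig := s * p / d%:R.

Let dR_gt0 : 0 < d%:R :> R. Proof. by rewrite ltr0n. Qed.
Let sig_gt0 : 0 < sig. Proof. by rewrite divr_gt0// mulr_gt0. Qed.

Lemma le1_powR (x r : R) : 0 <= r -> 1 <= x -> 1 <= x `^ r.
Proof.
move=> r0 x1; have := @ge0_ler_powR _ r r0 1 x.
by rewrite !nnegrE powR1 ler01 (le_trans _ x1)// => /(_ isT isT x1).
Qed.

Lemma le_pow_int_gkernel Q : 0 < Q -> exists2 C : R, 0 < C &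
  forall u (B : R) y, measurable_Rd u -> 0 < B -> (Lp_pow Q u <= B%:E)%E ->
  ((`|u y| `^ (p + Q * sig))%:E <=
   (C * B `^ sig)%:E * intRd (gkernel s p u y))%E.
Proof.
move=> Q0; set E := p + Q * sig.
have E0 : 0 < E by rewrite addr_gt0// mulr_gt0.
have sqd0 : 0 < Num.sqrt d%:R :> R by rewrite sqrtr_gt0.
pose c0 := (Num.sqrt d%:R / 2 : R) `^ (d%:R + s * p).
have c00 : 0 < c0 by rewrite powR_gt0// divr_gt0.
exists (2 `^ E * (c0 * 2 `^ (1 + sig))); first by rewrite !mulr_gt0// powR_gt0.
move=> u B y mu B0 HB; set D := intRd _.
have D0 : (0 <= D)%E by apply: intRd_ge0 => x; exact: gkernel_ge0.
have [uy0|uy0] := eqVneq (u y) 0.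
  rewrite uy0 normr0 powR0 ?gt_eqF// mule_ge0// lee_fin.
  by rewrite !mulr_ge0 ?powR_ge0// ltW.
pose v : R := `|u y|; rewrite -/v; have v0 : 0 < v by rewrite normr_gt0.
pose w : R := 2 / v; have w0 : 0 < w by rewrite divr_gt0.
have vw : v * w = 2 by rewrite /w mulrCA divff ?mulr1// gt_eqF.
(* [M] is the Chebyshev bound for the set where [|u| > v / 2], and [X] is the side of a cube of
   volume [2 * M]. The factor [K] brings the kernel up to at least 1 at points of that cube where
   [|u| <= v / 2]. *)
pose M := w `^ Q * B; have M0 : 0 < M by rewrite mulr_gt0// powR_gt0.
pose X := (2 * M) `^ d%:R^-1; have X0 : 0 < X by rewrite powR_gt0// mulr_gt0.
pose rho := X / 2; have rho0 : 0 < rho by rewrite divr_gt0.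
pose K := w `^ p * (Num.sqrt d%:R * rho) `^ (d%:R + s * p).
have dsp0 : 0 < d%:R + s * p by rewrite addr_gt0// mulr_gt0.
have K0 : 0 < K by rewrite mulr_gt0// powR_gt0// mulr_gt0.
(* Points of the cube with [|u x| > v / 2] are charged to the Chebyshev term; at the others
   [|u x - u y| >= v / 2], and they are charged to the kernel. *)
have pw x : (cube_ind y rho x <=
    K%:E * gkernel s p u y x + (w `^ Q)%:E * (`|u x| `^ Q)%:E)%E.
  have r0 : (0 <= (w `^ Q)%:E * (`|u x| `^ Q)%:E)%E by rewrite lee_fin mulr_ge0// powR_ge0.
  have l0 : (0 <= K%:E * gkernel s p u y x)%E.
    by rewrite mule_ge0// ?gkernel_ge0// lee_fin ltW.
  rewrite /cube_ind; case: (boolP (in_cube _ _ _)) => [xQ|_]; last exact: adde_ge0.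
  have [uxs|uxl] := leP (`|u x| * w) 1; last first.
    apply: (@le_trans _ _ ((w `^ Q)%:E * (`|u x| `^ Q)%:E)%E); last exact: leeDr.
    rewrite -EFinM lee_fin -powRM ?(ltW w0)// mulrC.
    by apply: le1_powR; exact: ltW.
  apply: (@le_trans _ _ (K%:E * gkernel s p u y x)%E); last exact: leeDl.
  have xy : x != y.
    by apply: contraTneq uxs => ->; rewrite -/v vw -ltNge ltr1n.
  have exy : 0 < enorm (x - y).
    rewrite lt_def enorm_ge0 andbT; apply: contraNneq xy => e0.
    apply/eqP/rowP => i; apply/eqP; rewrite -subr_eq0 -normr_le0 -e0.
    by have := coord_le_enorm (x - y) i; rewrite !mxE.
  rewrite -EFinM lee_fin /K mulrACA -powRM ?(ltW w0)//.
  rewrite -[leLHS](mulr1 1) ler_pM//.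
    apply: le1_powR; first exact: ltW.
    have : v <= `|u x - u y| + `|u x|.
      by rewrite /v distrC; have := ler_normD (u y - u x) (u x); rewrite subrK.
    move=> /(ler_wpM2r (ltW w0)); rewrite vw mulrDl => h; lra.
  rewrite ler_pdivlMr ?powR_gt0// mul1r.
  apply: ge0_ler_powR; rewrite ?nnegrE ?mulr_ge0 ?sqrtr_ge0//; try exact: ltW.
  exact/enorm_le_cube/xQ/ltW.
have int : ((2 * rho) ^+ d)%:E = (2 * M)%:E.
  congr (_%:E); rewrite /rho mulrC divfK// -powR_mulrn ?ltW// /X -powRrM.
  by rewrite mulVf ?gt_eqF// powRr1// ltW// mulr_gt0.
(* Of the volume [2 * M] the Chebyshev term absorbs at most [M], which is finite and cancels; the
   kernel must supply the rest. *)
have KD : (M%:E <= K%:E * D)%E.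
  have : ((2 * M)%:E <= K%:E * D + (w `^ Q * B)%:E)%E.
    rewrite -int -(intRd_cube y rho0).
    apply: (le_trans (le_intRd (cube_ind_ge0 _ _) pw)).
    rewrite intRdD; last 4 first.
    - by move=> x; rewrite mule_ge0// ?gkernel_ge0// lee_fin ltW.
    - by move=> x; rewrite lee_fin mulr_ge0// powR_ge0.
    - move=> dT T Z mZ; apply: emeasurable_funM => //.
      exact: (emeasurable_gkernel _ _ _ mu).
    - move=> dT T Z mZ; apply: emeasurable_funM => //.
      exact: (emeasurable_powR _ mu).
    rewrite (intRdZ (ltW K0) (gkernel_ge0 s p u y)); last exact: emeasurable_gkernel.
    have uQ0 x : (0 <= (`|u x| `^ Q)%:E)%E by rewrite lee_fin powR_ge0.
    rewrite (intRdZ (powR_ge0 w Q) uQ0); last exact: emeasurable_powR.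
    by rewrite leeD2l// EFinM lee_wpmul2l// lee_fin powR_ge0.
  rewrite -/M (_ : (2 * M)%:E = (M%:E + M%:E)%E); last by rewrite -EFinD; congr EFin; lra.
  by rewrite leeD2rE.
(* The power [d + s p] of [X] is the power [1 + sig] of [2 * M], and since [v * w = 2] all powers of
   [v] outside [M] cancel. This balance dictates both the exponent [E] and the constant. *)
have id : v `^ E * K = 2 `^ E * (c0 * 2 `^ (1 + sig)) * B `^ sig * M.
  have -> : K = w `^ p * (c0 * (2 * M * (2 `^ sig * (w `^ (Q * sig) * B `^ sig)))).
    rewrite /K; congr (_ * _).
    have -> : Num.sqrt d%:R * rho = Num.sqrt d%:R / 2 * X by rewrite /rho; ring.
    rewrite powRM ?ltW ?divr_gt0//; congr (_ * _).
    rewrite /X -powRrM (_ : d%:R^-1 * _ = 1 + sig); last first.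
      by rewrite /sig mulrDr mulVf ?gt_eqF// mulrC.
    rewrite powRD; last by rewrite gt_eqF// addr_gt0.
    have M20 : 0 <= 2 * M by rewrite mulr_ge0// ltW.
    rewrite (powRr1 M20); congr (_ * _).
    by rewrite powRM ?ltW// /M powRM ?powR_ge0 ?ltW// -powRrM.
  have e1 : v `^ E = v `^ p * v `^ (Q * sig) by rewrite powRD// gt_eqF.
  have e2 : 2 `^ E = v `^ p * w `^ p * (v `^ (Q * sig) * w `^ (Q * sig)).
    by rewrite -!powRM ?ltW// vw powRD// gt_eqF.
  have e3 : 2 `^ (1 + sig) = 2 * 2 `^ sig :> R.
    by rewrite powRD ?powRr1// gt_eqF// addr_gt0.
  by rewrite e1 e2 e3; ring.
have := @lee_wpmul2l _ ((v `^ E / M)%:E) _ _ _ KD.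
rewrite -EFinM divfK ?gt_eqF// muleA -EFinM.
rewrite mulrAC id mulfK ?gt_eqF//; apply.
by rewrite lee_fin divr_ge0// ?powR_ge0// ltW.
Qed.

Lemma Lp_pow_gain Q : 0 < Q -> exists2 C : R, 0 < C &
  forall u (B : R), measurable_Rd u -> 0 < B -> (Lp_pow Q u <= B%:E)%E ->
  (Lp_pow (p + Q * sig) u <= (C * B `^ sig)%:E * gagliardo_pow s p u)%E.
Proof.
move=> Q0; have [C C0 HC] := le_pow_int_gkernel Q0.
exists C => // u B mu B0 HB.
have k0 y : (0 <= intRd (gkernel s p u y))%E by apply: intRd_ge0 => x; exact: gkernel_ge0.
rewrite -(@intRdZ _ _ (fun y => intRd (gkernel s p u y))).
- by apply: le_intRd => y; [rewrite lee_fin powR_ge0|exact: HC].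
- by rewrite mulr_ge0// ?powR_ge0// ltW.
- exact: k0.
- exact: emeasurable_int_gkernel.
Qed.

(** A weighted geometric mean is at most the larger number, hence at most the sum. Losing the
    weights of Young's inequality only costs a factor 2 later. *)
Lemma geom_mean_le_add (x y t : R) : 0 <= x -> 0 <= y -> 0 <= t <= 1 ->
  x `^ (1 - t) * y `^ t <= x + y.
Proof.
move=> x0 y0 /andP[t0 t1].
have {}t1 : 0 <= 1 - t by rewrite subr_ge0.
have idp z : 0 <= z -> z `^ (1 - t) * z `^ t = z.
  by move=> z0; rewrite -powRD ?subrK ?powRr1// oner_eq0.
have [xy|/ltW yx] := leP x y.
  apply: (@le_trans _ _ (y `^ (1 - t) * y `^ t)); last by rewrite idp// lerDr.
  by rewrite ler_wpM2r ?powR_ge0// ge0_ler_powR.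
apply: (@le_trans _ _ (x `^ (1 - t) * x `^ t)); last by rewrite idp// lerDl.
by rewrite ler_wpM2l ?powR_ge0// ge0_ler_powR.
Qed.

(** After division by [A] and [B] both integrands have integral at most 1; the pointwise bound on
    their geometric mean then integrates to at most 2. *)
Lemma Lp_pow_interp u (q Q r A B t : R) : measurable_Rd u ->
  r = q * (1 - t) + Q * t -> r != 0 -> 0 <= t <= 1 -> 0 < A -> 0 < B ->
  (Lp_pow q u <= A%:E)%E -> (Lp_pow Q u <= B%:E)%E ->
  (Lp_pow r u <= (2 * (A `^ (1 - t) * B `^ t))%:E)%E.
Proof.
move=> mu rE r0 t01 A0 B0 HA HB; set c := A `^ (1 - t) * B `^ t.
have c0 : 0 <= c by rewrite mulr_ge0// powR_ge0.
have pw x : ((`|u x| `^ r)%:E <=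
    (c / A)%:E * (`|u x| `^ q)%:E + (c / B)%:E * (`|u x| `^ Q)%:E)%E.
  have [->|ux0] := eqVneq (u x) 0.
    by rewrite normr0 powR0// adde_ge0// -EFinM lee_fin mulr_ge0// ?powR_ge0// divr_ge0// ltW.
  have v0 : 0 < `|u x| by rewrite normr_gt0.
  rewrite -!EFinM -EFinD lee_fin.
  have q0 : 0 <= `|u x| `^ q / A by rewrite divr_ge0 ?powR_ge0// ltW.
  have Q0 : 0 <= `|u x| `^ Q / B by rewrite divr_ge0 ?powR_ge0// ltW.
  have h := geom_mean_le_add q0 Q0 t01.
  have -> : `|u x| `^ r = c * ((`|u x| `^ q / A) `^ (1 - t) * (`|u x| `^ Q / B) `^ t).
    rewrite rE powRD; last by rewrite (gt_eqF v0) implybT.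
    rewrite !powRrM /c mulrACA -(powRM _ (ltW A0) q0) -(powRM _ (ltW B0) Q0).
    by rewrite ![_ * (_ / _)]mulrC !divfK ?gt_eqF.
  apply: le_trans (ler_wpM2l c0 h) _.
  by rewrite le_eqVlt; apply/orP; left; apply/eqP; ring.
have mZ (k e : R) : emeasurable_Rd (fun x => k%:E * (`|u x| `^ e)%:E)%E.
  by move=> dT T Z mZ; apply: emeasurable_funM => //; exact: (emeasurable_powR _ mu).
have p0 (e : R) x : (0 <= (`|u x| `^ e)%:E)%E by rewrite lee_fin powR_ge0.
have cA0 : 0 <= c / A by rewrite divr_ge0// ltW.
have cB0 : 0 <= c / B by rewrite divr_ge0// ltW.
apply: (le_trans (le_intRd (p0 r) pw)).
rewrite intRdD//; try by move=> x; rewrite mule_ge0.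
rewrite !intRdZ//; try exact: emeasurable_powR.
apply: (@le_trans _ _ ((c / A)%:E * A%:E + (c / B)%:E * B%:E)%E).
  by rewrite leeD// lee_wpmul2l.
rewrite -!EFinM !divfK ?gt_eqF// -EFinD lee_fin.
by rewrite mulr2n mulrDl !mul1r.
Qed.

(** * Scale-invariant inequalities and iteration of the exponent *)

Section Scaling.
Variable q : R.
Hypotheses (q_gt0 : 0 < q) (sp_lt_d : s * p < d%:R).

Let del := d%:R * p - (d%:R - s * p) * q.
Hypothesis del_gt0 : 0 < del.

(* The exponents of [gagliardo_pow] and of [Lp_pow q] dictated by the two
   scalings [u |-> c u] and [u |-> u (l .)]. *)
Let al Q := d%:R * (Q - q) / del.
Let be Q := (d%:R * p - (d%:R - s * p) * Q) / del.

(** Positive upper bounds [A] and [G] stand in for the energies: every quantity raised to a power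
    stays positive along the induction, and zero energy is recovered by letting [G] tend to 0. *)
Definition GN_ineq (Q : R) : Prop := exists2 C : R, 0 < C &
  forall u (A G : R), measurable_Rd u -> 0 < A -> 0 < G ->
    (Lp_pow q u <= A%:E)%E -> (gagliardo_pow s p u <= G%:E)%E ->
    (Lp_pow Q u <= (C * (G `^ al Q * A `^ be Q))%:E)%E.

Lemma GN_ineq_base : GN_ineq q.
Proof.
exists 1 => // u A G mu A0 G0 HA HG.
rewrite /al /be subrr mulr0 mul0r powRr0 -/del divff ?gt_eqF// (powRr1 (ltW A0)).
by rewrite !mul1r.
Qed.

(** One gain step raises the previous bound to the power [sig] and multiplies it by [G]. The scaling
    exponents obey the same rule: [al] becomes [1 + al Q * sig] and [be] becomes [be Q * sig]. *)
Lemma GN_ineq_gain Q : 0 < Q -> GN_ineq Q -> GN_ineq (p + Q * sig).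
Proof.
move=> Q0 [C C0 HC]; have [C' C'0 HC'] := Lp_pow_gain Q0.
exists (C' * C `^ sig); first by rewrite mulr_gt0// powR_gt0.
move=> u A G mu A0 G0 HA HG.
have B0 : 0 < C * (G `^ al Q * A `^ be Q) by rewrite !mulr_gt0// powR_gt0.
apply: (le_trans (HC' _ _ mu B0 (HC _ _ _ mu A0 G0 HA HG))).
apply: (@le_trans _ _ ((C' * (C * (G `^ al Q * A `^ be Q)) `^ sig)%:E * G%:E)%E).
  by rewrite lee_wpmul2l// lee_fin mulr_ge0// ?powR_ge0// ltW.
rewrite -EFinM lee_fin.
have dn : d%:R != 0 :> R by rewrite gt_eqF.
have deln : del != 0 by rewrite gt_eqF.
have -> : al (p + Q * sig) = 1 + al Q * sig.
  by rewrite /al /sig; move: deln; rewrite /del => deln; field; rewrite dn deln.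
have -> : be (p + Q * sig) = be Q * sig.
  by rewrite /be /sig; field; rewrite dn deln.
rewrite powRM ?(ltW C0) ?mulr_ge0 ?powR_ge0// powRM ?powR_ge0// -!powRrM.
rewrite [G `^ (_ + _)]powRD; last by rewrite (gt_eqF G0) implybT.
rewrite (powRr1 (ltW G0)).
by rewrite le_eqVlt; apply/orP; left; apply/eqP; ring.
Qed.

(** [al] and [be] are affine in the exponent, with [al q = 0] and [be q = 1], so they interpolate
    with the same weight [t] as the exponent itself. *)
Lemma GN_ineq_interp Q r : q < r -> r <= Q -> GN_ineq Q -> GN_ineq r.
Proof.
move=> qr rQ [C C0 HC]; have qQ : 0 < Q - q by rewrite subr_gt0 (lt_le_trans qr).
have Qqn : Q - q != 0 by rewrite gt_eqF.
pose t := (r - q) / (Q - q).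
have t01 : 0 <= t <= 1.
  by rewrite /t divr_ge0 ?ler_pdivrMr ?mul1r ?lerB ?subr_ge0// ltW// -subr_gt0.
exists (2 * C `^ t); first by rewrite mulr_gt0// powR_gt0.
move=> u A G mu A0 G0 HA HG.
have B0 : 0 < C * (G `^ al Q * A `^ be Q) by rewrite !mulr_gt0// powR_gt0.
have rE : r = q * (1 - t) + Q * t by rewrite /t; field.
have r0 : r != 0 by rewrite gt_eqF// (lt_trans q_gt0).
apply: le_trans (Lp_pow_interp mu rE r0 t01 A0 B0 HA (HC _ _ _ mu A0 G0 HA HG)) _.
rewrite lee_fin.
have deln : del != 0 by rewrite gt_eqF.
have -> : al r = al Q * t by rewrite /al /t; field; rewrite deln Qqn.
have -> : be r = (1 - t) + be Q * t.
  by rewrite /be /t; move: deln; rewrite /del => deln; field; rewrite deln Qqn.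
rewrite powRM ?(ltW C0) ?mulr_ge0 ?powR_ge0// powRM ?powR_ge0// -!powRrM.
rewrite [A `^ (1 - t + _)]powRD; last by rewrite (gt_eqF A0) implybT.
by rewrite le_eqVlt; apply/orP; left; apply/eqP; ring.
Qed.

Let sig_lt1 : sig < 1. Proof. by rewrite ltr_pdivrMr ?mul1r. Qed.

Lemma GN_ineq_subcritical r : q < r -> (d%:R - s * p) * r < d%:R * p -> GN_ineq r.
Proof.
move=> qr rp.
pose ps := p / (1 - sig).
have s1 : 0 < 1 - sig by rewrite subr_gt0.
have rps : r < ps.
  rewrite /ps ltr_pdivlMr// -(ltr_pM2l dR_gt0); apply: le_lt_trans rp.
  by rewrite /sig le_eqVlt; apply/orP; left; apply/eqP; field; rewrite gt_eqF.
(* Closed form of the orbit of [q] under the exponent map: each step shrinks the distance to the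
   fixed point [ps] by the factor [sig < 1]. *)
pose Q k := ps - sig ^+ k * (ps - q).
have QS k : Q k.+1 = p + Q k * sig.
  by rewrite /Q /ps exprS; field; rewrite gt_eqF.
have qps : 0 < ps - q by rewrite subr_gt0 (lt_trans qr).
have Qq k : q <= Q k.
  have /(ler_wpM2r (ltW qps)) : sig ^+ k <= 1 by apply: exprn_ile1; exact: ltW.
  by rewrite /Q; lra.
have GQ k : GN_ineq (Q k).
  elim: k => [|k IH]; first by rewrite /Q expr0 mul1r opprB addrC subrK; exact: GN_ineq_base.
  by rewrite QS; apply: GN_ineq_gain => //; exact: lt_le_trans (Qq k).
have [k hk] : exists k, sig ^+ k * (ps - q) < ps - r.
  have : (fun k => sig ^+ k) @ \oo --> (0 : R) by apply: cvg_expr; rewrite gtr0_norm.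
  have e0 : 0 < (ps - r) / (ps - q) by rewrite divr_gt0// subr_gt0.
  move=> /cvgrPdist_lt /(_ _ e0) [k _ /(_ k)] /=.
  rewrite leqnn => /(_ isT); rewrite sub0r normrN ger0_norm ?exprn_ge0 ?ltW//.
  by rewrite ltr_pdivlMr// => ?; exists k.
apply: (@GN_ineq_interp (Q k)) => //; rewrite /Q; lra.
Qed.
End Scaling.
End GagliardoNirenberg.

(** * A smooth bump function *)

Section FlatExponential.
Variable R : realType.

(** The negative powers of [t] are included because differentiating exp(-1/t) produces them: the
    whole family is closed under derivatives up to linear combinations. *)
Definition flat_exp (k : nat) (t : R) : R :=
  if 0 < t then t^-1 ^+ k * expR (- t^-1) else 0.

Lemma expR_dominates (n : nat) (x : R) : 0 <= x -> x ^+ n * expR (- x) <= n`!%:R.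
Proof.
move=> x0; rewrite expRN ler_pdivrMr ?expR_gt0//.
case: n => [|n]; first by rewrite expr0 mul1r (le_trans _ (expR_ge1Dx x))// lerDl.
have := expR_ge1Dxn n x0; rewrite -(ler_pM2l (_ : 0 < n.+1`!%:R)) ?ltr0n ?fact_gt0//.
apply: le_trans; rewrite mulrDr mulr1 mulrCA divff ?mulr1 ?lerDr//.
Qed.

Lemma flat_exp_ge0 k t : 0 <= flat_exp k t.
Proof.
rewrite /flat_exp; case: ltP => // t0.
by rewrite mulr_ge0 ?expR_ge0// exprn_ge0// invr_ge0 ltW.
Qed.

Lemma flat_exp_le k t : flat_exp k t <= k`!%:R.
Proof.
rewrite /flat_exp; case: ltP => // t0.
by rewrite expR_dominates// invr_ge0 ltW.
Qed.

(** For [t > 0] one has [flat_exp k t = t * flat_exp k.+1 t] with a bounded second factor. The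
    resulting decay at 0 yields the derivative there. *)
Lemma flat_exp_le_lin k t : flat_exp k t <= k.+1`!%:R * `|t|.
Proof.
case: (ltP 0 t) => t0; last by rewrite {1}/flat_exp ltNge t0 mulr_ge0.
rewrite -ler_pdivrMr ?normr_gt0 ?gt_eqF// gtr0_norm//.
have := flat_exp_le k.+1 t; rewrite /flat_exp t0 exprS; apply: le_trans.
by rewrite -mulrA mulrC.
Qed.

Lemma is_derive_flat_exp k (t : R) :
  is_derive t 1 (flat_exp k) (flat_exp k.+2 t - k%:R * flat_exp k.+1 t).
Proof.
have [t0|t0|t0] := ltgtP t 0.
- have e j : flat_exp j t = 0 by rewrite /flat_exp ltNge (ltW t0).
  rewrite !e mulr0 subr0.
  apply: (@near_eq_is_derive _ _ _ (cst (0 : R))).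
  near=> x; rewrite /flat_exp ifF//; apply/negbTE; rewrite -leNgt.
  by rewrite ltW//; near: x; exact: lt_nbhsl.
- have e j : flat_exp j t = t^-1 ^+ j * expR (- t^-1) by rewrite /flat_exp t0.
  rewrite !e.
  apply: (@near_eq_is_derive _ _ _ (fun x : R => x^-1 ^+ k * expR (- x^-1))).
    near=> x; rewrite /flat_exp ifT//.
    by near: x; exact: lt_nbhsr.
  have tn : t != 0 by rewrite gt_eqF.
  have dV : is_derive t 1 (fun x : R => x^-1) (- t ^- 2 *: 1).
    exact: (@is_deriveV _ id t 1 1 tn).
  have dE : is_derive t 1 (fun x : R => expR (- x^-1)) (expR (- t^-1) * - (- t ^- 2 *: 1)).
    exact: (@is_derive1_comp _ expR (fun x : R => - x^-1)).
  have dX : is_derive t 1 (fun x : R => x^-1 ^+ k) (k%:R * t^-1 ^+ k.-1 * (- t ^- 2)).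
    have := @is_deriveX _ _ (fun x : R => x^-1) k t 1 _ dV.
    rewrite (_ : (fun x : R => x^-1) ^+ k = (fun x : R => x^-1 ^+ k)).
      by move=> h; apply: (is_derive_eq h); rewrite /GRing.scale/= mulr1.
    by apply: funext => x; rewrite fctE.
  have := @is_deriveM _ _ (fun x : R => x^-1 ^+ k) (fun x : R => expR (- x^-1)) t 1 _ _ dX dE.
  move=> h; apply: (is_derive_eq h); rewrite /GRing.scale/= mulr1.
  case: k {dX h} => [|k]; rewrite /= ?exprS; field; rewrite ?tn//.
- have e j : flat_exp j 0 = 0 by rewrite /flat_exp ltxx.
  rewrite t0 !e mulr0 subr0.
  (* At 0 the difference quotient of [flat_exp k] is exactly [flat_exp k.+1 h], which is O(h). *)
  have lim0 : h^-1 *: ((flat_exp k \o shift 0) (h *: 1) - flat_exp k 0) @[h --> 0^'] --> (0 : R).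
    apply/cvgrPdist_le => eps eps0; near=> h.
    have h0 : h != 0 by near: h; exact: nbhs_dnbhs_neq.
    have -> : h^-1 *: ((flat_exp k \o shift 0) (h *: 1) - flat_exp k 0) = flat_exp k.+1 h.
      rewrite /= addr0 /GRing.scale/= mulr1 /flat_exp ltxx subr0.
      by case: ifP => _; rewrite ?mulr0// mulrA -exprS.
    rewrite sub0r normrN ger0_norm ?flat_exp_ge0//.
    apply: le_trans (flat_exp_le_lin _ _) _.
    rewrite -ler_pdivlMl ?ltr0n ?fact_gt0// ltW//.
    near: h; apply: dnbhs0_lt; rewrite mulr_gt0// invr_gt0 ltr0n fact_gt0//.
  split; first exact: cvgP lim0.
  exact: cvg_lim lim0.
Unshelve. all: by end_near.
Qed.
End FlatExponential.

Section FlatExponentialRegularity.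
Variable R : realType.

Lemma differentiable_flat_exp k (t : R) : differentiable (flat_exp k) t.
Proof. by apply/derivable1_diffP; have [] := is_derive_flat_exp k t. Qed.

Lemma continuous_flat_exp k : continuous (@flat_exp R k).
Proof. by move=> t; apply: differentiable_continuous; exact: differentiable_flat_exp. Qed.

(** The derivative of [flat_exp 0] is [flat_exp 2], which lies between 0 and [2! = 2]. *)
Lemma flat_exp_lipschitz (a b : R) :
  `|flat_exp 0 a - flat_exp 0 b| <= 2 * `|a - b|.
Proof.
wlog ab : a b / a <= b => [H|].
  by have [/H//|/ltW/H] := leP a b; rewrite distrC [X in _ <= _ * X]distrC.
have cont : {within `[a, b], continuous (@flat_exp R 0)}.
  by apply: continuous_subspaceT; exact: continuous_flat_exp.
have [c _ E] := MVT_segment ab (fun x _ => is_derive_flat_exp 0 x) cont.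
rewrite distrC E [`|a - b|]distrC normrM ler_wpM2r//.
by rewrite mul0r subr0 ger0_norm ?flat_exp_ge0// (flat_exp_le 2).
Qed.
End FlatExponentialRegularity.

(** * The bump on R^d: smoothness, support and quantitative bounds *)

Section Bump.
Variables (R : realType) (d : nat).

Definition bump_fun (x : 'rV[R]_d) : R := flat_exp 0 (1 - \sum_(i < d) x ord0 i ^+ 2).

(* A class of functions closed under directional derivatives and containing [bump_fun]. *)
Inductive bump_algebra : ('rV[R]_d -> R) -> Prop :=
| bump_algebra_cst c : bump_algebra (cst c)
| bump_algebra_coord i : bump_algebra (fun x => x ord0 i)
| bump_algebraD f g : bump_algebra f -> bump_algebra g -> bump_algebra (f + g)
| bump_algebraM f g : bump_algebra f -> bump_algebra g -> bump_algebra (f * g)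
| bump_algebra_flat k f : bump_algebra f -> bump_algebra (flat_exp k \o f).

(** The rules for derivatives need differentiability of the parts, so both claims share one
    induction. The chain rule raises the index of [flat_exp], which is why the class contains every
    index. *)
Lemma bump_algebra_derive f : bump_algebra f ->
  (forall x, differentiable f x) /\ (forall v, bump_algebra (fun x => 'D_v f x)).
Proof.
elim=> {f} [c|i|f g _ [df Df] _ [dg Dg]|f g mf [df Df] mg [dg Dg]|k f mf [df Df]].
- split=> [x|v]; first exact: differentiable_cst.
  rewrite (_ : (fun x => _) = cst 0); first exact: bump_algebra_cst.
  by apply: funext => x; rewrite derive_cst.
- split=> [x|v]; first exact: differentiable_coord.
  rewrite (_ : (fun x => _) = cst (v ord0 i)); first exact: bump_algebra_cst.
  apply: funext => x; apply/cvg_lim => //; apply: cvg_near_cst.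
  near=> h; rewrite /= !mxE addrK scalerA mulVf ?scale1r//.
  by near: h; exact: nbhs_dnbhs_neq.
- split=> [x|v]; first exact: differentiableD.
  rewrite (_ : (fun x => _) = (fun x => 'D_v f x) + (fun x => 'D_v g x)).
    exact: bump_algebraD.
  by apply: funext => x; rewrite deriveD//; exact: diff_derivable.
- split=> [x|v]; first exact: differentiableM.
  rewrite (_ : (fun x => _) = f * (fun x => 'D_v g x) + g * (fun x => 'D_v f x)).
    by apply: bump_algebraD; exact: bump_algebraM.
  by apply: funext => x; rewrite deriveM//; exact: diff_derivable.
- have dc x : differentiable (flat_exp k \o f) x.
    by apply: differentiable_comp => //; exact: differentiable_flat_exp.
  split=> // v.
  rewrite (_ : (fun x => _) = (fun x => 'D_v f x) *
    ((flat_exp k.+2 \o f) + cst (- k%:R) * (flat_exp k.+1 \o f))).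
    apply: bump_algebraM => //; apply: bump_algebraD; first exact: bump_algebra_flat.
    by apply: bump_algebraM; [exact: bump_algebra_cst|exact: bump_algebra_flat].
  apply: funext => x; rewrite deriveE// diff_comp//; last exact: differentiable_flat_exp.
  rewrite /= diff1E; last exact: differentiable_flat_exp.
  rewrite derive1E (@derive_val _ _ _ _ _ _ _ (is_derive_flat_exp k (f x))).
  by rewrite -deriveE// mulNr.
Unshelve. all: by end_near.
Qed.

Lemma bump_smooth : smooth bump_fun.
Proof.
move=> vs; suff : bump_algebra (iter_derive vs bump_fun) by case/bump_algebra_derive.
elim: vs => [|v vs IH]; last by have [_] := bump_algebra_derive IH; exact.
apply: (@bump_algebra_flat 0 (fun x => 1 - \sum_(i < d) x ord0 i ^+ 2)).
rewrite (_ : (fun x => _) = cst 1 + cst (-1) *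
  \sum_(i < d) (fun x : 'rV[R]_d => x ord0 i) * (fun x : 'rV[R]_d => x ord0 i)).
  apply: bump_algebraD; first exact: bump_algebra_cst.
  apply: bump_algebraM; first exact: bump_algebra_cst.
  elim/big_ind: _ => [|f g|i _]; [exact: bump_algebra_cst|exact: bump_algebraD|].
  by apply: bump_algebraM; exact: bump_algebra_coord.
by apply: funext => x; rewrite !fctE /cst mulN1r fct_sumE.
Qed.

Lemma bump_ge0 x : 0 <= bump_fun x. Proof. exact: flat_exp_ge0. Qed.

Lemma bump_le1 x : bump_fun x <= 1. Proof. exact: (flat_exp_le 0). Qed.

Lemma bump_eq0 (x : 'rV[R]_d) i : 1 <= `|x ord0 i| -> bump_fun x = 0.
Proof.
move=> x1; rewrite /bump_fun /flat_exp ifF//; apply/negbTE; rewrite -leNgt subr_le0.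
rewrite (bigD1 i)//= -(real_normK (num_real (x ord0 i))).
rewrite (le_trans (_ : _ <= `|x ord0 i| ^+ 2)) ?expr_ge1//.
by rewrite lerDl sumr_ge0// => j _; exact: sqr_ge0.
Qed.

Lemma bump_Cc_infty : Cc_infty bump_fun.
Proof.
split; first exact: bump_smooth.
have sub : closure [set x | bump_fun x != 0] `<=` [set x : 'rV[R]_d | `|x| <= 1].
  have cl : closed [set x : 'rV[R]_d | `|x| <= 1].
    apply: (@closed_comp _ _ (fun x : 'rV[R]_d => `|x|) [set r | r <= 1]).
      by move=> x _; exact: norm_continuous.
    exact: closed_le.
  rewrite [X in _ `<=` X]((closure_id _).1 cl); apply: closure_subset => x /= bx.
  rewrite [`|x|]mx_normrE; apply: bigmax_le => // -[i j] _ /=.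
  rewrite (ord1 i) leNgt; apply: contraNN bx => /ltW h.
  by apply/eqP; exact: bump_eq0 h.
apply: bounded_closed_compact; last exact: closed_closure.
exists 1; split=> // M M1 x /sub /= h; exact: le_trans h (ltW M1).
Qed.

Lemma bump_measurable : measurable_Rd bump_fun.
Proof.
rewrite /measurable_Rd; apply: (@measurableT_comp _ _ _ _ _ _ (@flat_exp R 0)).
  by apply: continuous_measurable_fun; exact: continuous_flat_exp.
apply: measurable_funB => //; apply: measurable_sum => i.
apply: measurable_funX; under eq_fun do rewrite mxE.
exact: measurable_tnth.
Qed.

(** If one point has all coordinates below 1 in absolute value, those of the other are below 2, so
    squares of coordinates differ by at most [3 * rho]; summing and using the Lipschitz constant 2
    gives [6 d]. Otherwise both values vanish. *)
Lemma bump_lipschitz (x y : 'rV[R]_d) (rho : R) : rho <= 1 ->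
  (forall i, `|x ord0 i - y ord0 i| <= rho) ->
  `|bump_fun x - bump_fun y| <= 6 * d%:R * rho.
Proof.
move=> rho1 xy.
have sym (a b : 'rV[R]_d) : (forall i, `|a ord0 i - b ord0 i| <= rho) ->
    (forall i, `|b ord0 i| < 1) -> `|bump_fun a - bump_fun b| <= 6 * d%:R * rho.
  move=> ab b1; apply: le_trans (flat_exp_lipschitz _ _) _.
  have -> : 1 - \sum_(i < d) a ord0 i ^+ 2 - (1 - \sum_(i < d) b ord0 i ^+ 2) =
      \sum_(i < d) b ord0 i ^+ 2 - \sum_(i < d) a ord0 i ^+ 2 by lra.
  have -> : 6 * d%:R * rho = 2 * (d%:R * (3 * rho)) by ring.
  rewrite ler_pM2l// -sumrB (le_trans (ler_norm_sum _ _ _))//.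
  rewrite -[d in d%:R]card_ord mulr_natl -sumr_const.
  apply: ler_sum => i _; rewrite subr_sqr normrM distrC mulrC /=.
  apply: ler_pM => //.
  have := ab i; have := b1 i; rewrite !ler_norml !ltr_norml => /andP[? ?] /andP[? ?].
  by apply/andP; split; lra.
have [/existsP[i hi]|] := boolP [exists i, 1 <= `|y ord0 i|]; last first.
  rewrite negb_exists => /forallP h; apply: sym => // i.
  by have := h i; rewrite -ltNge.
have [/existsP[j hj]|] := boolP [exists i, 1 <= `|x ord0 i|]; last first.
  rewrite negb_exists => /forallP h; rewrite distrC; apply: sym => k.
    by rewrite distrC.
  by have := h k; rewrite -ltNge.
rewrite (bump_eq0 hi) (bump_eq0 hj) subrr normr0 !mulr_ge0//.
exact: le_trans (xy i).
Qed.

(** The half-side is small enough for the sum of squares to stay below 1/2, and exp(-1/t) is at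
    least exp(-2) for [t >= 1/2]. Using [d.+1] keeps the denominator positive for every [d]. *)
Lemma bump_lower (x : 'rV[R]_d) :
  (forall i, `|x ord0 i| <= (2 * d.+1%:R)^-1) -> expR (- 2) <= bump_fun x.
Proof.
move=> hx; rewrite /bump_fun.
have h2 : 2^-1 <= 1 - \sum_(i < d) x ord0 i ^+ 2.
  set c := (2 * d.+1%:R)^-1 in hx.
  have dpos : 0 < 2 * d.+1%:R :> R by rewrite mulr_gt0// ltr0n.
  have c1 : c <= 1 by rewrite invf_le1// -natrM ler1n.
  have dc : d%:R * c <= 2^-1.
    rewrite /c ler_pdivrMr// mulrA mulVf// mul1r ler_nat leqnSn //.
  have : \sum_(i < d) x ord0 i ^+ 2 <= \sum_(i < d) c.
    apply: ler_sum => i _; rewrite -(real_normK (num_real (x ord0 i))) expr2.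
    by rewrite -[leRHS]mul1r ler_pM// (le_trans (hx i)).
  by rewrite sumr_const card_ord -mulr_natl; lra.
rewrite /flat_exp expr0 mul1r (lt_le_trans _ h2)// ler_expR lerN2.
by rewrite -[leRHS]invrK lef_pV2 ?posrE ?invr_gt0// (lt_le_trans _ h2).
Qed.
End Bump.

(** * Finite energy of the bump function *)

Section BumpEnergy.
Variable R : realType.

Lemma dyadic_scale (t : R) : 1 <= t -> exists k, 2 ^+ k <= t < 2 ^+ k.+1.
Proof.
move=> t1; have ex : exists n, t < 2 ^+ n.
  have [n tn] : exists n : nat, t < n%:R.
    by exists (Num.bound t); apply: le_lt_trans (archi_boundP _); [|exact: le_trans t1].
  by exists n; apply: (lt_le_trans tn); rewrite -natrX ler_nat ltnW// ltn_expl.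
case: (ex_minnP ex) => -[|k] tk mk; first by rewrite expr0 in tk; lra.
exists k; rewrite tk andbT leNgt; apply/negP => /mk.
by rewrite ltnn.
Qed.

Lemma nneseries_geometric_le (a z : R) : 0 <= a -> 0 < z -> z < 1 ->
  (\sum_(k <oo) (a * z ^+ k)%:E <= (a / (1 - z))%:E)%E.
Proof.
move=> a0 z0 z1; apply: lime_le.
  by apply: is_cvg_nneseries => k _ _; rewrite lee_fin mulr_ge0// exprn_ge0// ltW.
apply: nearW => n; rewrite sumEFin lee_fin.
by have := @geometric_le_lim _ n a z a0 z0; rewrite ger0_norm ?(ltW z0)// => /(_ z1).
Qed.

Lemma nneseries_ge_term (f : nat -> \bar R) k : (forall n, 0 <= f n)%E ->
  (f k <= \sum_(n <oo) f n)%E.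
Proof.
move=> f0; apply: le_trans (nneseries_lim_ge k.+1 _) => //.
by rewrite big_nat_recr//= leeDr// sume_ge0.
Qed.

Lemma two_powR_lt1 (a : R) : a < 0 -> 2 `^ a < 1.
Proof.
move=> a0; rewrite lt_neqAle powR_eq1 -[X in _ <= X](powRr0 2) ler_powR ?ler1n ?ltW// andbT.
by rewrite (lt_eqF a0) orbF negb_or -leNgt ler0n pnatr_eq1.
Qed.

Variable d : nat.
Implicit Types x y c : 'rV[R]_d.

Lemma in_cubeE c (rho : R) x : 0 <= rho -> in_cube c rho x = (`|x - c| <= rho).
Proof.
move=> rho0; apply/forallP/idP => [h|h i].
  rewrite [`|x - c|]mx_normrE; apply: bigmax_le => // -[i j] _ /=.
  by rewrite (ord1 i) !mxE.
apply: le_trans h; rewrite [`|x - c|]mx_normrE.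
have := @le_bigmax _ _ _ (0 : R) (fun ij : 'I_1 * 'I_d => `|(x - c) ij.1 ij.2|) (ord0, i).
by rewrite !mxE.
Qed.

Lemma norm_le_enorm x : `|x| <= enorm x.
Proof.
rewrite [`|x|]mx_normrE; apply: bigmax_le => [|[i j] _ /=]; first exact: enorm_ge0.
by rewrite (ord1 i) coord_le_enorm.
Qed.

(** A discrete majorant of a power of the distance to [c]: it is at least [a * z ^+ k] on the cube
    of half-side [rho * w ^+ k], and its integral is a geometric series of ratio [z * w ^+ d]. With
    [w = 1/2] it models a singularity at [c], with [w = 2] a tail at infinity. *)
Definition cube_series c (a rho z w : R) x : \bar R :=
  (\sum_(k <oo) (a * z ^+ k)%:E * cube_ind c (rho * w ^+ k) x)%E.

Lemma cube_series_ge c (a rho z w : R) x k : 0 <= a -> 0 <= z ->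
  in_cube c (rho * w ^+ k) x -> ((a * z ^+ k)%:E <= cube_series c a rho z w x)%E.
Proof.
move=> a0 z0 xk.
have -> : (a * z ^+ k)%:E = ((a * z ^+ k)%:E * cube_ind c (rho * w ^+ k) x)%E.
  by rewrite /cube_ind xk mule1.
apply: (@nneseries_ge_term (fun k => (a * z ^+ k)%:E * cube_ind c (rho * w ^+ k) x)%E) => n.
by rewrite mule_ge0 ?cube_ind_ge0// lee_fin mulr_ge0// exprn_ge0.
Qed.

Lemma cube_series_ge0 c (a rho z w : R) x : 0 <= a -> 0 <= z ->
  (0 <= cube_series c a rho z w x)%E.
Proof.
move=> a0 z0; apply: nneseries_ge0 => n _ _.
by rewrite mule_ge0 ?cube_ind_ge0// lee_fin mulr_ge0// exprn_ge0.
Qed.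

Lemma emeasurable_cube_term c (a rho : R) :
  emeasurable_Rd (fun x => a%:E * cube_ind c rho x)%E.
Proof.
by move=> dT T X mX; apply: emeasurable_funM => //; exact: emeasurable_cube_ind.
Qed.

Lemma emeasurable_cube_series c (a rho z w : R) : 0 <= a -> 0 <= z ->
  emeasurable_Rd (cube_series c a rho z w).
Proof.
move=> a0 z0 dT T X mX.
apply: (@ge0_emeasurable_sum _ _ _ _
  (fun k t => (a * z ^+ k)%:E * cube_ind c (rho * w ^+ k) (X t))%E xpredT) => k.
  by move=> t _ _; rewrite mule_ge0 ?cube_ind_ge0// lee_fin mulr_ge0// exprn_ge0.
by move=> _; exact: emeasurable_cube_term.
Qed.

Lemma intRd_cube_series c (a rho z w : R) :
  0 <= a -> 0 < rho -> 0 < z -> 0 < w -> z * w ^+ d < 1 ->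
  (intRd (cube_series c a rho z w) <=
   (a * (2 * rho) ^+ d / (1 - z * w ^+ d))%:E)%E.
Proof.
move=> a0 rho0 z0 w0 zw1.
have az0 k : 0 <= a * z ^+ k by rewrite mulr_ge0// exprn_ge0// ltW.
rewrite intRd_nneseries.
- apply: le_trans (nneseries_geometric_le _ _ zw1); last 2 first.
  + by rewrite mulr_ge0// exprn_ge0// mulr_ge0// ltW.
  + by rewrite mulr_gt0// exprn_gt0.
  rewrite le_eqVlt; apply/orP; left; apply/eqP; apply: eq_eseriesr => k _.
  rewrite intRdZ//; [|exact: cube_ind_ge0|exact: emeasurable_cube_ind].
  rewrite intRd_cube ?mulr_gt0 ?exprn_gt0// -EFinM; congr EFin.
  by rewrite !exprMn -[w ^+ k ^+ d]exprM mulnC exprM; ring.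
- by move=> k x; rewrite mule_ge0 ?cube_ind_ge0// lee_fin.
- by move=> k; exact: emeasurable_cube_term.
Qed.

Lemma Lp_pow_bump_lty (e : R) : 0 < e -> (Lp_pow e (@bump_fun R d) < +oo)%E.
Proof.
move=> e0; apply: (@le_lt_trans _ _ (intRd (cube_ind (0 : 'rV[R]_d) 1))).
  apply: le_intRd => x; first by rewrite lee_fin powR_ge0.
  rewrite lee_fin; case: (boolP (in_cube _ _ _)) => [_|].
    have := @ge0_ler_powR _ e (ltW e0) `|bump_fun x| 1.
    by rewrite !nnegrE powR1 ger0_norm ?bump_ge0// => ->//; exact: bump_le1.
  rewrite negb_forall => /existsP[i]; rewrite mxE subr0 -ltNge => /ltW/bump_eq0 ->.
  by rewrite normr0 powR0// gt_eqF.
by rewrite intRd_cube// ltry.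
Qed.

Lemma Lp_pow_bump_gt0 (e : R) : 0 < e -> (0 < Lp_pow e (@bump_fun R d))%E.
Proof.
move=> e0; pose c := (2 * d.+1%:R : R)^-1.
have c0 : 0 < c by rewrite invr_gt0 mulr_gt0// ltr0n.
have k0 : 0 < expR (- 2) `^ e :> R by rewrite powR_gt0// expR_gt0.
apply: (@lt_le_trans _ _ ((expR (- 2) `^ e)%:E * intRd (cube_ind (0 : 'rV[R]_d) c))%E).
  by rewrite intRd_cube// -EFinM lte_fin mulr_gt0// exprn_gt0// mulr_gt0.
rewrite -(intRdZ (ltW k0)); [|exact: cube_ind_ge0|exact: emeasurable_cube_ind].
apply: le_intRd => x; first by rewrite mule_ge0 ?cube_ind_ge0// lee_fin ltW.
rewrite /cube_ind; case: (boolP (in_cube _ _ _)) => [/forallP h|_]; last first.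
  by rewrite mule0 lee_fin powR_ge0.
rewrite mule1 lee_fin ge0_ler_powR ?nnegrE ?expR_ge0 ?(ltW e0)// ger0_norm ?bump_ge0//.
by apply: bump_lower => i; have := h i; rewrite mxE subr0.
Qed.

Variables s p : R.
Hypotheses (s_gt0 : 0 < s) (s_lt1 : s < 1) (p_gt0 : 0 < p).

Let be : R := d%:R + s * p.
Let be_gt0 : 0 < be. Proof. by rewrite ltr_wpDl// mulr_gt0. Qed.

Let two_powRn (a : R) n : (2 `^ a) ^+ n = (2 ^+ n) `^ a :> R.
Proof. by rewrite -powR_mulrn ?powR_ge0// -powRrM mulrC powRrM powR_mulrn. Qed.

(** The ratio is 2 to the power [- s p], so [s p > 0] makes the tail summable. *)
Let far_ratio_lt1 : 2 `^ (- be) * 2 ^+ d < 1 :> R.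
Proof.
rewrite -[2 ^+ d]powR_mulrn// -powRD ?pnatr_eq0 ?implybT//.
apply: two_powR_lt1; rewrite /be.
by have : 0 < s * p by [rewrite mulr_gt0]; lra.
Qed.

Lemma gkernel_le (N D : R) u x y : 0 < N -> N <= `|x - y| -> `|u x - u y| <= D ->
  (gkernel s p u y x <= (D `^ p * N `^ (- be))%:E)%E.
Proof.
move=> N0 Nxy uD; have D0 : 0 <= D by exact: le_trans uD.
rewrite lee_fin powRN; apply: ler_pM; rewrite ?invr_ge0 ?powR_ge0//.
  by rewrite ge0_ler_powR ?nnegrE// ltW.
have Ne : N <= enorm (x - y) by exact: le_trans Nxy (norm_le_enorm _).
rewrite lef_pV2 ?posrE ?powR_gt0//; last exact: lt_le_trans Ne.
by rewrite ge0_ler_powR ?nnegrE ?enorm_ge0 ?(ltW N0) ?(ltW be_gt0).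
Qed.

(** The Lipschitz constant of the bump to the power [p], times the loss from bounding [|x - y|]
    below by the next dyadic scale. *)
Let near_amp : R := (6 * d%:R) `^ p * 2 `^ be.

(** On the shell [|x - y| ~ 2^-k] the Lipschitz bound leaves 2 to the power [k (be - p)]; on
    [|x - y| ~ 2^k] the increment is at most 1 and the kernel decays like 2 to the power
    [- k be]. *)
Lemma bump_gkernel_le x y : (gkernel s p (@bump_fun R d) y x <=
  cube_series y near_amp 1 (2 `^ (be - p)) 2^-1 x +
  cube_series y 1 2 (2 `^ (- be)) 2 x)%E.
Proof.
have na0 : 0 <= near_amp by rewrite mulr_ge0// powR_ge0.
have s1 := cube_series_ge0 y 1 2^-1 x na0 (powR_ge0 2 (be - p)).
have s2 := cube_series_ge0 y 2 2 x (@ler01 R) (powR_ge0 2 (- be)).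
have [xy|xy] := eqVneq x y.
  apply: le_trans (adde_ge0 s1 s2).
  by rewrite /gkernel xy [_ - bump_fun y]subrr normr0 powR0 ?gt_eqF// mul0r.
have N0 : 0 < `|x - y| by rewrite normr_gt0 subr_eq0.
have [N1|N1] := leP `|x - y| 1.
  have [k /andP[k1 k2]] : exists k, 2 ^+ k <= `|x - y|^-1 < 2 ^+ k.+1.
    by apply: dyadic_scale; rewrite invf_ge1.
  have p2k n : 0 < 2 ^+ n :> R by rewrite exprn_gt0.
  have xyk : `|x - y| <= 2^-1 ^+ k.
    by rewrite exprVn -[leLHS]invrK lef_pV2 ?posrE ?invr_gt0.
  have kxy : (2 ^+ k.+1)^-1 <= `|x - y|.
    by rewrite -[leRHS]invrK lef_pV2 ?posrE ?invr_gt0// ltW.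
  have rk0 : 0 <= 2^-1 ^+ k :> R by rewrite exprn_ge0.
  have cub : in_cube y (2^-1 ^+ k) x by rewrite in_cubeE.
  apply: le_trans (leeDl _ s2).
  apply: le_trans (cube_series_ge (k := k) na0 (powR_ge0 _ _) _); last by rewrite mul1r.
  have lip : `|bump_fun x - bump_fun y| <= 6 * d%:R * 2^-1 ^+ k.
    by apply: bump_lipschitz; [rewrite exprn_ile1 ?invf_le1 ?ler1n|exact/forallP].
  have kp : 0 < (2 ^+ k.+1)^-1 :> R by rewrite invr_gt0.
  apply: le_trans (gkernel_le kp kxy lip) _.
  rewrite lee_fin le_eqVlt; apply/orP; left; apply/eqP.
  rewrite powRM ?mulr_ge0// /near_amp -[in LHS]mulrA -[in RHS]mulrA; congr (_ * _).
  have -> : 2^-1 ^+ k = 2 `^ (- k%:R) :> R by rewrite powRN powR_mulrn// exprVn.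
  have -> : (2 ^+ k.+1)^-1 = 2 `^ (- k.+1%:R) :> R by rewrite powRN powR_mulrn.
  rewrite -[in RHS]powR_mulrn ?powR_ge0// -!powRrM -!powRD ?pnatr_eq0 ?implybT//.
  by congr (_ `^ _); rewrite -natr1; ring.
have [k /andP[k1 k2]] := dyadic_scale (ltW N1).
have cub : in_cube y (2 * 2 ^+ k) x by rewrite in_cubeE -?exprS ?exprn_ge0// ltW.
apply: le_trans (leeDr _ s1).
apply: le_trans (cube_series_ge (k := k) (@ler01 R) (powR_ge0 _ _) cub).
have d1 : `|bump_fun x - bump_fun y| <= 1.
  have := bump_ge0 x; have := bump_le1 x; have := bump_ge0 y; have := bump_le1 y.
  by rewrite ler_norml => *; apply/andP; split; lra.
have p2k : 0 < 2 ^+ k :> R by rewrite exprn_gt0.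
apply: le_trans (gkernel_le p2k k1 d1) _.
by rewrite powR1 !mul1r two_powRn.
Qed.

Lemma int_bump_gkernel_bound : exists2 M : R, 0 <= M &
  forall y, (intRd (gkernel s p (@bump_fun R d) y) <= M%:E)%E.
Proof.
have na0 : 0 <= near_amp by rewrite mulr_ge0// powR_ge0.
(* The ratio is 2 to the power [s p - p]: here [s < 1] makes the singularity on the diagonal
   integrable. *)
have z1 : 2 `^ (be - p) * 2^-1 ^+ d < 1 :> R.
  rewrite exprVn -powR_mulrn// -powRN -powRD ?pnatr_eq0 ?implybT//.
  apply: two_powR_lt1; rewrite /be.
  by have : s * p < 1 * p by [rewrite ltr_pM2r]; lra.
set M1 := near_amp * (2 * 1) ^+ d / (1 - 2 `^ (be - p) * 2^-1 ^+ d).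
set M2 : R := 1 * (2 * 2) ^+ d / (1 - 2 `^ (- be) * 2 ^+ d).
exists (M1 + M2).
  by rewrite addr_ge0// /M1 /M2 divr_ge0 ?mulr_ge0 ?exprn_ge0// subr_ge0 ltW.
move=> y; apply: le_trans (le_intRd (gkernel_ge0 _ _ _ _) (bump_gkernel_le ^~ y)) _.
have p2 (a : R) : 0 < 2 `^ a :> R by rewrite powR_gt0.
rewrite intRdD; [|move=> x; exact: cube_series_ge0 (powR_ge0 _ _)
                 |move=> x; exact: cube_series_ge0 (powR_ge0 _ _)
                 |exact: emeasurable_cube_series (powR_ge0 _ _)
                 |exact: emeasurable_cube_series (powR_ge0 _ _)].
by rewrite EFinD leeD// intRd_cube_series.
Qed.

(** The uniform bound on the inner integral is not integrable in [y], so decay is needed. Far out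
    the bump vanishes at [y], only [x] in the unit cube contributes, and there
    [|x - y| >= |y| - 1 >= |y| / 2]. *)
Lemma int_bump_gkernel_far y : 2 < `|y| ->
  (intRd (gkernel s p (@bump_fun R d) y) <= (2 ^+ d * (`|y| / 2) `^ (- be))%:E)%E.
Proof.
move=> y2; have y0 : 0 < `|y| / 2 by rewrite divr_gt0// (lt_trans _ y2).
have by0 : bump_fun y = 0.
  have [/existsP[i]|] := boolP [exists i, 1 <= `|y ord0 i|]; first exact: bump_eq0.
  rewrite negb_exists => /forallP h; suff : `|y| <= 1 by lra.
  rewrite -[y]subr0 -in_cubeE//; apply/forallP => i; rewrite mxE subr0 leNgt.
  by apply: contra (h i) => /ltW.
apply: (@le_trans _ _ (intRd (fun x => ((`|y| / 2) `^ (- be))%:E * cube_ind 0 1 x)%E)).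
  apply: le_intRd => x; first exact: gkernel_ge0.
  have [/existsP[i /bump_eq0 bx0]|] := boolP [exists i, 1 <= `|x ord0 i|].
    rewrite /gkernel by0 bx0 subrr normr0 powR0 ?gt_eqF// mul0r.
    by rewrite mule_ge0 ?cube_ind_ge0// lee_fin powR_ge0.
  rewrite negb_exists => /forallP h.
  have x1 : in_cube 0 1 x.
    apply/forallP => i; rewrite mxE subr0 leNgt; apply: contra (h i) => /ltW//.
  rewrite /cube_ind x1 mule1.
  have b1 : `|bump_fun x - bump_fun y| <= 1 by rewrite by0 subr0 ger0_norm ?bump_ge0 ?bump_le1.
  have yx : `|y| / 2 <= `|x - y|.
    move: x1; rewrite in_cubeE// subr0 => x1.
    have := lerB_dist y x; rewrite distrC; lra.
  by apply: le_trans (gkernel_le y0 yx b1) _; rewrite powR1 mul1r.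
rewrite intRdZ ?powR_ge0//; [|exact: cube_ind_ge0|exact: emeasurable_cube_ind].
by rewrite intRd_cube// mulr1 -EFinM mulrC.
Qed.

Lemma gagliardo_pow_bump_lty : (gagliardo_pow s p (@bump_fun R d) < +oo)%E.
Proof.
have [M M0 HM] := int_bump_gkernel_bound.
have a0 : 0 <= 2 ^+ d :> R by rewrite exprn_ge0.
have z0 := powR_ge0 (2 : R) (- be).
apply: (@le_lt_trans _ _ (intRd (fun y => M%:E * cube_ind 0 2 y +
    cube_series 0 (2 ^+ d) 4 (2 `^ (- be)) 2 y)%E)).
  apply: le_intRd => y; first by apply: intRd_ge0 => x; exact: gkernel_ge0.
  have s0 := cube_series_ge0 0 4 2 y a0 z0.
  have c0 : (0 <= M%:E * cube_ind 0 2 y)%E by rewrite mule_ge0 ?cube_ind_ge0.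
  have [y2|y2] := leP `|y| 2.
    apply: le_trans (leeDl _ s0); rewrite /cube_ind in_cubeE// subr0 y2 mule1.
    exact: HM.
  apply: le_trans (leeDr _ c0).
  have [k /andP[k1 k2]] : exists k, 2 ^+ k <= `|y| / 2 < 2 ^+ k.+1.
    by apply: dyadic_scale; rewrite ler_pdivlMr ?mul1r// ltW.
  (* The factor 4 comes from [|y| / 2 < 2 ^+ k.+1]. *)
  have cub : in_cube 0 (4 * 2 ^+ k) y.
    rewrite in_cubeE ?subr0 ?mulr_ge0 ?exprn_ge0//.
    by move: k2; rewrite exprS; lra.
  apply: le_trans (cube_series_ge a0 z0 cub).
  apply: le_trans (int_bump_gkernel_far y2) _.
  rewrite lee_fin ler_wpM2l// two_powRn !powRN lef_pV2 ?posrE ?powR_gt0 ?exprn_gt0//; last first.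
    by apply: lt_le_trans k1; rewrite exprn_gt0.
  rewrite ge0_ler_powR ?nnegrE ?(ltW be_gt0) ?exprn_ge0//.
rewrite intRdD; [|by move=> x; rewrite mule_ge0 ?cube_ind_ge0
  |by move=> x; exact: cube_series_ge0
  |exact: emeasurable_cube_term|exact: emeasurable_cube_series].
rewrite intRdZ//; [|exact: cube_ind_ge0|exact: emeasurable_cube_ind].
rewrite intRd_cube// -EFinM lte_add_pinfty ?ltry//.
by apply: le_lt_trans (intRd_cube_series _ _ _ _ _ far_ratio_lt1) (ltry _) => //; rewrite powR_gt0.
Qed.
End BumpEnergy.

(** * The optimal constant *)

Section Attainment.
Variables (R : realType) (U : Type) (D : U -> Prop) (N K : U -> \bar R).
Hypotheses (N_ge0 : forall u, (0 <= N u)%E) (K_ge0 : forall u, (0 <= K u)%E).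

(* Only the test element [u0] needs a finite [K]: wherever [K u = +oo] the
   inequality holds for every positive constant. *)
Lemma exists_optimal_constant (L1 : R) (u0 : U) :
  (forall u, D u -> N u <= L1%:E * K u)%E ->
  D u0 -> (0 < N u0)%E -> (K u0 < +oo)%E ->
  exists L : R, 0 < L /\ (forall u, D u -> N u <= L%:E * K u)%E /\
    (forall L' : R, (forall u, D u -> N u <= L'%:E * K u)%E -> L <= L').
Proof.
move=> HL1 Du0 N0 Ky; pose S := [set L : R | forall u, D u -> (N u <= L%:E * K u)%E].
have SL1 : S L1 by [].
have [k0 kE] : exists k0, K u0 = k0%:E.
  by move: Ky (K_ge0 u0); case: (K u0) => // r _ _; exists r.
have [n0 nE] : exists n0, N u0 = n0%:E.
  move: (HL1 _ Du0) (N_ge0 u0); rewrite kE -EFinM.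
  by case: (N u0) => // r _ _; exists r.
have n0_gt0 : 0 < n0 by rewrite -lte_fin -nE.
have k0_gt0 : 0 < k0.
  rewrite lt_def -lee_fin -kE K_ge0 andbT; apply/eqP => k00.
  by have := HL1 _ Du0; rewrite kE k00 mule0 leNgt N0.
have lb : lbound S (n0 / k0).
  by move=> L' /(_ _ Du0); rewrite nE kE -EFinM lee_fin ler_pdivrMr.
have S0 : S !=set0 by exists L1.
have L0 : 0 < inf S by apply: lt_le_trans (lb_le_inf S0 lb); rewrite divr_gt0.
exists (inf S); split => //; split => [u Du|L' HL']; last first.
  by apply: ge_inf => //; exists (n0 / k0).
have := HL1 _ Du; move: (K_ge0 u) (N_ge0 u).
case kuE: (K u) => [k| |] // k_ge0; last by move=> _ _; rewrite gt0_muley ?lte_fin// leey.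
rewrite -!EFinM; case nuE: (N u) => [n| |] // _ _; rewrite lee_fin.
move: k_ge0; rewrite lee_fin le_eqVlt => /orP[/eqP k00|k_gt0].
  (* When [K u = 0] no quotient is available, but the admissible [L1] already forces [N u = 0]. *)
  by have := HL1 _ Du; rewrite kuE nuE -k00 mule0 mulr0 lee_fin.
rewrite -ler_pdivrMr//; apply: lb_le_inf => // L' /(_ _ Du).
by rewrite nuE kuE -EFinM lee_fin ler_pdivrMr.
Qed.
End Attainment.

Lemma poweR_finite (R : realType) (x : \bar R) (e : R) :
  (0 <= x)%E -> (x < +oo)%E -> (poweR x e < +oo)%E.
Proof. by case: x => // x _ _; rewrite ltry. Qed.

(** * From bounds on energies to the inequality between norms *)

Section GNConstant.
Variables (R : realType) (d : nat) (p s q : R).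

Lemma Lp_pow_ge0 (e : R) (u : 'rV[R]_d -> R) : (0 <= Lp_pow e u)%E.
Proof. by apply: intRd_ge0 => x; rewrite lee_fin powR_ge0. Qed.

Lemma gagliardo_pow_ge0 (u : 'rV[R]_d -> R) : (0 <= gagliardo_pow s p u)%E.
Proof. by apply: intRd_ge0 => y; apply: intRd_ge0 => x; exact: gkernel_ge0. Qed.

Lemma bump_in_Dpqs : 0 < p -> 0 < q -> in_Dpqs s p q (@bump_fun R d).
Proof.
move=> p0 q0; have pn : p != 0 by rewrite gt_eqF.
split; last split.
- split; first exact: bump_measurable.
  exists (fun=> @bump_fun R d); split=> [_|w]; first exact: bump_Cc_infty.
  rewrite [X in X @ _ --> _](_ : _ = cst 0%E); first exact: cvg_cst.
  apply: funext => n; rewrite /w /Lp_pow /gagliardo_pow /intRd.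
  under [X in iter_lebesgue_int _ X]eq_fun do rewrite subrr normr0 powR0//.
  rewrite iter_int_cst0 add0e -[RHS](@iter_int_cst0 R d); congr iter_lebesgue_int.
  apply: funext => y; rewrite -[RHS](@iter_int_cst0 R d); congr iter_lebesgue_int.
  by apply: funext => x; rewrite !subrr normr0 powR0// mul0r.
- by split; [exact: bump_measurable|exact: Lp_pow_bump_lty].
- exact: Lp_pow_bump_gt0.
Qed.

Hypotheses (d_gt0 : (0 < d)%N) (p_gt1 : 1 < p) (s_gt0 : 0 < s)
  (sp_lt_d : s * p < d%:R) (pq : p < q).
Let del := d%:R * p - (d%:R - s * p) * q.
Hypothesis del_gt0 : 0 < del.
Let r := p * (q - 1) / (p - 1).
Let a := d%:R * (q - p) / ((q - 1) * del).

Let p_gt0 : 0 < p. Proof. exact: lt_trans p_gt1. Qed.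
Let q_gt0 : 0 < q. Proof. exact: lt_trans pq. Qed.
Let dR_gt0 : 0 < d%:R :> R. Proof. by rewrite ltr0n. Qed.
Let q1 : 0 < q - 1. Proof. by rewrite subr_gt0 (lt_trans p_gt1). Qed.
Let p1 : 0 < p - 1. Proof. by rewrite subr_gt0. Qed.
Let r_gt0 : 0 < r. Proof. by rewrite divr_gt0// mulr_gt0. Qed.
Let a_gt0 : 0 < a. Proof. by rewrite divr_gt0// mulr_gt0// subr_gt0. Qed.

(** Taking the power [1 / r] turns the scaling exponents into [al / r = a / p] and
    [be / r = (1 - a) / q], the powers in the claim. Infinite and zero seminorms are treated
    apart. *)
Lemma gagliardo_nirenberg : GN_ineq d p s q r ->
  exists L : R, forall u : 'rV[R]_d -> R, in_Dpqs s p q u ->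
    (Lp_norm r u <= L%:E *
      (poweR (gagliardo s p u) a * poweR (Lp_norm q u) (1 - a)))%E.
Proof.
case=> C C0 HC; exists (C `^ r^-1) => u [_ [[mu Aoo] up0]].
have [A A0 AE] : exists2 A : R, 0 < A & Lp_pow q u = A%:E.
  have A0 : (0 < Lp_pow q u)%E.
    rewrite lt_def Lp_pow_ge0 andbT; apply: contraTneq up0 => /Lp_pow_eq0.
    by rewrite -leNgt => -> //; rewrite gt_eqF.
  move: Aoo A0; case: (Lp_pow q u) => // A _ A0; exists A => //.
have An0 : Lp_norm q u = (A `^ q^-1)%:E by rewrite /Lp_norm AE.
have Y0 : (0 < poweR (Lp_norm q u) (1 - a))%E.
  by rewrite An0 /= lte_fin !powR_gt0.
have L0 : 0 < C `^ r^-1 by rewrite powR_gt0.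
have := gagliardo_pow_ge0 u.
case GE: (gagliardo_pow s p u) => [g| |] // g0; last first.
  (* With infinite seminorm the right side is infinite: [a > 0] and the factor from the [L^q] norm
     is positive. *)
  rewrite /gagliardo GE !poweRyr ?invr_eq0 ?gt_eqF// gt0_mulye//.
  by rewrite gt0_muley ?leey ?lte_fin.
rewrite lee_fin in g0.
set al := d%:R * (r - q) / del; set be := (d%:R * p - (d%:R - s * p) * r) / del.
have bnd : (Lp_pow r u <= (C * (g `^ al * A `^ be))%:E)%E.
  move: g0; rewrite le_eqVlt => /orP[/eqP g00|g_gt0]; last first.
    by apply: HC => //; rewrite ?AE ?GE.
  (* Zero seminorm: since [q < r] the power [al] of [G] is positive, so the bound tends to 0 with
     [G]. *)
  have al_gt0 : 0 < al.
    rewrite divr_gt0// mulr_gt0// subr_gt0 /r ltr_pdivlMr// -subr_gt0.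
    by rewrite (_ : _ - _ = q - p) ?subr_gt0//; ring.
  rewrite -g00 powR0 ?gt_eqF// mul0r mulr0; apply/lee_addgt0Pr => e e0.
  (* Chosen so that taking [G] to be the power [1 / al] of [c] makes the bound equal to [e]. *)
  pose c := e / (C * A `^ be).
  have c0 : 0 < c by rewrite divr_gt0// mulr_gt0// powR_gt0.
  have h0 : 0 < c `^ al^-1 by rewrite powR_gt0.
  rewrite add0e; apply: le_trans (HC _ _ _ mu A0 h0 _ _) _.
  - by rewrite AE.
  - by rewrite GE lee_fin -g00 ltW.
  rewrite lee_fin -/al -/be -powRrM mulVf ?gt_eqF// powRr1 ?(ltW c0)// mulrCA.
  by rewrite /c divfK// gt_eqF// mulr_gt0// powR_gt0.
have X : gagliardo s p u = (g `^ p^-1)%:E by rewrite /gagliardo GE.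
rewrite An0 X /= -!powRrM -!EFinM.
apply: (@le_trans _ _ (poweR (C * (g `^ al * A `^ be))%:E r^-1)).
  apply: gt0_ler_poweR => //; first by rewrite invr_ge0 ltW.
    by rewrite in_itv/= Lp_pow_ge0 leey.
  rewrite in_itv/= leey andbT; exact: le_trans (Lp_pow_ge0 _ _) bnd.
rewrite lee_fin powRM ?(ltW C0) ?mulr_ge0 ?powR_ge0// powRM ?powR_ge0// -!powRrM.
have rn : r != 0 by rewrite gt_eqF.
have deln : d%:R * p - (d%:R - s * p) * q != 0 by rewrite gt_eqF.
have [pn qn q1n p1n] : [/\ p != 0, q != 0, q - 1 != 0 & p - 1 != 0].
  by split; rewrite gt_eqF.
have -> : al / r = p^-1 * a.
  by rewrite /al /a /r /del; field; rewrite deln pn q1n p1n.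
have -> // : be / r = q^-1 * (1 - a).
by rewrite /be /a /r /del; field; rewrite deln pn qn q1n p1n.
Qed.
End GNConstant.

Theorem theorem1p4 (R : realType) (d : nat) (p s q : R) :
  (1 <= d)%N -> 1 < p -> 0 < s -> s < 1 -> s * p < d%:R ->
  p < q -> q < p * (d%:R - s) / (d%:R - s * p) ->
  let r := p * (q - 1) / (p - 1) in
  let a := d%:R * (q - p) /
           ((q - 1) * (d%:R * p - (d%:R - s * p) * q)) in
  exists L : R, 0 < L /\
    (forall u : 'rV[R]_d -> R, in_Dpqs s p q u ->
       (Lp_norm r u <=
        L%:E * poweR (gagliardo s p u) a * poweR (Lp_norm q u) (1 - a))%E) /\
    (forall L' : R,
       (forall u : 'rV[R]_d -> R, in_Dpqs s p q u ->
          (Lp_norm r u <=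
           L'%:E * poweR (gagliardo s p u) a * poweR (Lp_norm q u) (1 - a))%E) ->
       L <= L').
Proof.
move=> d0 p1 s0 s1 spd pq qub r a.
have p0 : 0 < p by exact: lt_trans p1.
have q0 : 0 < q by exact: lt_trans pq.
have dsp : 0 < d%:R - s * p by rewrite subr_gt0.
have dq : q * (d%:R - s * p) < p * (d%:R - s) by rewrite -ltr_pdivlMr.
have ps : 0 < p * s by rewrite mulr_gt0.
have del_gt0 : 0 < d%:R * p - (d%:R - s * p) * q by lra.
have p11 : 0 < p - 1 by rewrite subr_gt0.
have qr : q < r by rewrite /r ltr_pdivlMr//; lra.
(* After multiplication by [p - 1] this is the upper bound on [q]: subcriticality of [r] means
   [(d - s p) (q - 1) < d (p - 1)]. *)
have rp : (d%:R - s * p) * r < d%:R * p.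
  rewrite /r mulrA ltr_pdivrMr// -subr_gt0.
  rewrite (_ : _ - _ = p * (d%:R * (p - 1) - (d%:R - s * p) * (q - 1))); last by ring.
  by rewrite mulr_gt0// subr_gt0; lra.
have GN := GN_ineq_subcritical d0 p0 s0 q0 spd del_gt0 qr rp.
have [L1 HL1] := gagliardo_nirenberg d0 p1 pq del_gt0 GN.
have r0 : 0 < r by exact: lt_trans qr.
pose N (u : 'rV[R]_d -> R) := Lp_norm r u.
pose K (u : 'rV[R]_d -> R) :=
  (poweR (gagliardo s p u) a * poweR (Lp_norm q u) (1 - a))%E.
have N0 u : (0 <= N u)%E by exact: poweR_ge0.
have K0 u : (0 <= K u)%E by rewrite mule_ge0// poweR_ge0.
have Nb : (0 < N (@bump_fun R d))%E by rewrite poweR_gt0// Lp_pow_bump_gt0.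
have Kb : (K (@bump_fun R d) < +oo)%E.
  apply: lte_mul_pinfty; rewrite ?poweR_ge0//; last first.
    apply: poweR_finite; first exact: poweR_ge0.
    by apply: poweR_finite; [exact: Lp_pow_ge0|exact: Lp_pow_bump_lty].
  rewrite ge0_fin_numE ?poweR_ge0//; apply: poweR_finite; first exact: poweR_ge0.
  by apply: poweR_finite; [exact: gagliardo_pow_ge0|exact: gagliardo_pow_bump_lty].
have [L [L0 [HL HLmin]]] :=
  exists_optimal_constant N0 K0 HL1 (bump_in_Dpqs d s p0 q0) Nb Kb.
exists L; split=> //; split=> [u Du|L' HL']; first by rewrite -muleA; exact: HL.
by apply: HLmin => u Du; rewrite muleA; exact: HL'.
Qed.
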